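(* There is an event $\Omega_{\mathrm{nr}}$ of probability one such that, for every $\omega\in\Omega_{\mathrm{nr}}$, $$\sum_n c_n\lambda_n(\omega)\ne0$$ for every nonzero finitely supported integer sequence $c=(c_n)_{n\ge1}\in\mathbb Z^{(\mathbb N)}$.
   Context: $\rho\in\mathbb R\setminus\{0\}$ is fixed, $\mathbb N=\{1,2,\dots\}$, $\mathbb Z^{(\mathbb N)}$ is the set of finitely supported integer sequences, and $B=(B_x)_{0\le x\le\pi}$ is a standard real Brownian motion (with $B_0=0$ and continuous paths) on a probability space $(\Omega,\mathcal F,\mathbb P)$. For $\omega\in\Omega$ put $\sigma=\rho B(\omega)$ and $y^{[1]}=y'-\sigma y$. The Dirichlet operator $A_\omega=-\partial_x^2+\rho\dot B_x(\omega)$ on $L^2(0,\pi)$ is defined by $A_\omega y=-(y^{[1]})'-\sigma y^{[1]}-\sigma^2y$ on $\{y\in L^2(0,\pi): y,y^{[1]}\in AC[0,\pi],\ A_\omega y\in L^2,\ y(0)=y(\pi)=0\}$. It is self-adjoint, bounded below, with compact resolvent and simple eigenvalues, enumerated as $\lambda_1(\omega)<\lambda_2(\omega)<\cdots\to+\infty$. *)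

(* Defs.v *)
From mathcomp Require Import all_boot all_order all_algebra finmap.
From mathcomp Require Import all_classical all_reals all_analysis.
Import Order.TTheory GRing.Theory Num.Theory.
Import numFieldNormedType.Exports.

Set Implicit Arguments.
Unset Strict Implicit.
Unset Printing Implicit Defensive.

Local Open Scope classical_set_scope.
Local Open Scope ring_scope.

Section BrownianMotion.
Context {d : measure_display} {T : measurableType d} {R : realType}.
Variable P : probability T R.

(* The sets [A i] may be the whole line, so the product rule for all subfamilies
   is included. *)
Definition independent_rvs (n : nat) (X : 'I_n -> T -> R) : Prop :=
  forall A : 'I_n -> set R, (forall i, measurable (A i)) ->
    P (\bigcap_(i in [set: 'I_n]) (X i @^-1` A i)) =
    (\prod_(i < n) fine (P (X i @^-1` A i)))%:E.

Definition increment (B : R -> {RV P >-> R}) (s t : R) : T -> R := B t \- B s.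

(* Standard Brownian motion with time set [0, pi]; the variables [B x] with [x]
   outside [0, pi] are unconstrained and irrelevant. The second parameter of
   [normal_prob] is the standard deviation. *)
Record brownian_motion (B : R -> {RV P >-> R}) : Prop := BrownianMotion {
  brownian0 : forall w, B 0 w = 0;
  brownian_continuous :
    forall w, {within `[0, pi], continuous (fun x : R => B x w)};
  brownian_gaussian : forall s t : R, 0 <= s -> s < t -> t <= pi ->
    forall A : set R, measurable A ->
      pushforward P (increment B s t) A = normal_prob 0 (Num.sqrt (t - s)) A;
  brownian_independent : forall (n : nat) (t : nat -> R),
    0 <= t 0%N -> (forall i, (i < n)%N -> t i < t i.+1) -> t n <= pi ->
    independent_rvs (fun i : 'I_n => increment B (t i) (t i.+1))
}.

End BrownianMotion.

Section DirichletOperator.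
Context {R : realType}.
Implicit Types (a b l : R) (f s y u : R -> R).

Local Notation mu := (@lebesgue_measure R).

Definition abs_continuous a b f : Prop :=
  forall e : R, 0 < e -> exists2 del : R, 0 < del &
    forall (n : nat) (p q : 'I_n -> R),
      (forall i, [/\ a <= p i, p i <= q i & q i <= b]) ->
      trivIset [set: 'I_n] (fun i => `]p i, q i[%classic) ->
      \sum_(i < n) (q i - p i) < del ->
      \sum_(i < n) `|f (q i) - f (p i)| < e.

(* Elements of L^2(0, pi) are represented by functions on the whole line, of
   which only the restriction to ]0, pi[ matters, up to equality a.e. *)
Definition in_L2 f : Prop := f \_ `]0, pi[ \in Lfun mu 2%:E.

Definition ae_eq0pi f g : Prop := ae_eq mu `]0, pi[%classic f g.

(* [u] is the absolutely continuous representative of the quasi-derivative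
   y^[1] = y' - s y, which is itself only defined almost everywhere. *)
Definition quasi_derivative s y u : Prop :=
  abs_continuous 0 pi u /\
  {ae mu, forall x : R, x \in `]0, pi[ ->
     derivable y x 1 /\ u x = derive1 y x - s x * y x}.

(* The graph of the Dirichlet operator: [y] is in the domain and [A y = f]. *)
Definition dirichlet_op s y f : Prop :=
  [/\ in_L2 y, in_L2 f, abs_continuous 0 pi y, y 0 = 0 /\ y pi = 0 &
    exists2 u, quasi_derivative s y u &
      {ae mu, forall x : R, x \in `]0, pi[ ->
         derivable u x 1 /\
         f x = - derive1 u x - s x * u x - s x ^+ 2 * y x}].

Definition dirichlet_eigenvalue s l : Prop :=
  exists2 y, ~ ae_eq0pi y (cst 0) & dirichlet_op s y (fun x => l * y x).

(* [lam n] is the (n+1)-st eigenvalue, i.e. the sequence is numbered from 0. *)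
Definition dirichlet_enumeration s (lam : nat -> R) : Prop :=
  [/\ forall m n : nat, (m < n)%N -> lam m < lam n,
      range lam = [set l | dirichlet_eigenvalue s l] &
      lam n @[n --> \oo] --> +oo].

End DirichletOperator.

(* Main.v *)
(* A number [l] is an eigenvalue exactly when the solution [y] of the initial
   value problem [y(0) = 0, y^[1](0) = 1] vanishes at [pi]. If [y] and [z] are
   such Dirichlet solutions for [(s, l)] and for [(s + t min(., b), l')], the
   Wronskian gives [(l' - l) \int_0^pi y z = t \int_0^b y z]. Hence if
   [\sum_n c_n l_n = 0] and [\sum_n c_n l'_n = 0] with [t != 0], then
   [\sum_n c_n (\int_0^b y_n z_n) / (\int_0^pi y_n z_n) = 0]. Since the squares
   of the eigenfunctions are linearly independent, this fails near any given
   resonant path for some rational [b]; so the resonant paths are covered by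
   countably many measurable sets that meet each line [s + R min(., b)] at most
   once, and no branch of eigenvalues has to be followed. The law of Brownian
   motion is quasi-invariant along [min(., b)] (Cameron-Martin), so infinitely
   many disjoint translates of such a set would have probabilities bounded below
   unless the set is null. *)
From HB Require Import structures.
Require Import Defs.
From mathcomp Require Import all_boot all_order all_algebra finmap.
From mathcomp Require Import all_classical all_reals all_analysis.
From mathcomp Require Import measurable_realfun.
From mathcomp Require Import ring lra.
Import Order.TTheory GRing.Theory Num.Theory.
Import numFieldNormedType.Exports.

Local Open Scope classical_set_scope.
Local Open Scope ring_scope.

Set Implicit Arguments.
Unset Strict Implicit.

(** * Derivatives and primitives *)

Section calculus.
Context {R : realType}.
Implicit Types (f df F : R -> R) (a b x C : R).

(** Nothing is known about the measurability of the functions [lam n], so the exceptional event must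
    be built without them: it is described by zeros of [shoot] at tuples confined to compact
    rational boxes, which yields sets closed for uniform convergence, hence measurable on continuous
    paths. The directions min(., b) are chosen because the Cameron-Martin density along them depends
    on [B b] alone, so no stochastic integral appears, and because the Wronskian can be integrated
    by hand on both sides of the kink. The isolation statement has to be uniform over pairs of paths
    and pairs of tuples near one resonant path; this is why solutions are shown to be Lipschitz in
    the pair (s, l), with constants depending only on bounds. The operator is defined by
    almost-everywhere equations, and the passage to a classical linear system rests on the constancy
    of absolutely continuous functions with zero derivative almost everywhere. The coefficients stay
    real until the end: integrality enters through the countability of the coefficient vectors, each
    having its own null set. *)

Lemma is_derive1_continuous f x (l : R) :
  is_derive x 1 f l -> {for x, continuous f}.
Proof.
by move=> [fx _]; apply/differentiable_continuous; exact/derivable1_diffP.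
Qed.

Lemma MVT_closed f df a b : a <= b ->
  (forall x, a <= x <= b -> is_derive x 1 f (df x)) ->
  exists2 c, a <= c <= b & f b - f a = df c * (b - a).
Proof.
move=> ab fE; have [||c cab ->] := @MVT_segment _ f df a b ab.
- by move=> x; rewrite in_itv/= => /andP[ax xb]; apply: fE; rewrite !ltW.
- apply/continuous_in_subspaceT => x /[!inE]/=; rewrite in_itv/= => /fE.
  exact: is_derive1_continuous.
- by exists c => //; move: cab; rewrite in_itv.
Qed.

Lemma nondecreasing_derive f df a b : a <= b ->
  (forall x, a <= x <= b -> is_derive x 1 f (df x)) ->
  (forall x, a <= x <= b -> 0 <= df x) -> f a <= f b.
Proof.
move=> ab fE df0; have [c /df0 c0 fc] := MVT_closed ab fE.
by rewrite -subr_ge0 fc mulr_ge0// subr_ge0.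
Qed.

Lemma constant_derive0 f a b : a <= b ->
  (forall x, a <= x <= b -> is_derive x 1 f 0) -> f b = f a.
Proof.
move=> ab fE; have [c _] := MVT_closed (df := cst 0) ab fE.
by rewrite mul0r => /eqP; rewrite subr_eq0 => /eqP.
Qed.

Lemma dist_derive_le f df a b C : a <= b ->
  (forall x, a <= x <= b -> is_derive x 1 f (df x)) ->
  (forall x, a <= x <= b -> `|df x| <= C) -> `|f b - f a| <= C * (b - a).
Proof.
move=> ab fE dfC; have [c /dfC c0 ->] := MVT_closed ab fE.
by rewrite normrM ler_pM// ger0_norm// subr_ge0.
Qed.

Lemma ex_local_primitive f a : continuous f ->
  exists F : R -> R, forall x, a < x -> is_derive x 1 F (f x).
Proof.
move=> cf; exists (fun x => (\int[lebesgue_measure]_(t in `[a, x]) f t)%R) => x ax.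
have [||//||dF F'] :=
  @continuous_FTC1_closed R f a x (x + 1); rewrite ?ltrDl//.
- apply: continuous_compact_integrable; first exact: segment_compact.
  exact: continuous_subspaceT.
- exact: cf.
- by rewrite -F' derive1E; exact: derivableP.
Qed.

(** Primitives on the half-lines []- n - 1, +oo[], normalised at 0, agree where both are defined, so
    they glue to a primitive on the whole line. *)
Lemma ex_primitive f : continuous f ->
  exists F : R -> R, F 0 = 0 /\ forall x, is_derive x 1 F (f x).
Proof.
move=> cf.
have /choice[G GE] : forall n : nat, exists F : R -> R,
    forall x, - n%:R - 1 < x -> is_derive x 1 F (f x).
  by move=> n; exact: ex_local_primitive.
have G0 (m n : nat) x : - m%:R - 1 < x -> - n%:R - 1 < x ->
    G m x - G m 0 = G n x - G n 0.
  move=> mx nx; pose D z := G m z - G n z.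
  have D' (z : R) : - m%:R - 1 < z -> - n%:R - 1 < z -> is_derive z 1 D 0.
    move=> mz nz; rewrite -(subrr (f z)).
    by have := GE m z mz; have := GE n z nz; move=> ? ?; exact: (@is_deriveB _ _ _ (G m) (G n)).
  have m0 : (0 : R) <= m%:R by []. have n0 : (0 : R) <= n%:R by [].
  suff : D x = D 0 by rewrite /D; lra.
  have [x0|x0] := leP 0 x.
    by apply: constant_derive0 => // z /andP[? ?]; apply: D'; lra.
  apply/esym; apply: constant_derive0; first exact: ltW.
  by move=> z /andP[? ?]; apply: D'; lra.
pose F x := G (Num.truncn `|x|).+1 x - G (Num.truncn `|x|).+1 0.
exists F; split=> [|x]; first by rewrite /F subrr.
have big (z : R) n : `|z| < n%:R -> - n%:R - 1 < z.
  by rewrite ltr_norml => /andP[]; lra.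
pose n := (Num.truncn `|x|).+2.
have xn : `|x| < n%:R.
  by rewrite (lt_trans (truncnS_gt _))// ltr_nat.
have dG : is_derive x 1 (fun z => G n z - G n 0) (f x).
  have := GE n x (big _ _ xn) => ?.
  by rewrite -[f x]subr0; apply: is_deriveB.
apply: (@near_eq_is_derive _ _ _ (fun z => G n z - G n 0)) => //.
have : \forall z \near x, `|z| < n%:R.
  exact: (@norm_continuous _ R^o x _ (lt_nbhsl xn)).
apply: filterS => z /= zn.
by rewrite /F; apply: G0; apply: big => //; exact: truncnS_gt.
Qed.

(** For continuous [f] this is the integral from 0, of either sign of the argument. Only its value
    at 0 and its derivative are ever used, so integrals are handled by differentiation rules;
    [cst 0] is the value when no primitive exists. *)
Definition prim f : R -> R :=
  xget (cst 0) [set F : R -> R | F 0 = 0 /\ forall x, is_derive x 1 F (f x)].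

Lemma primP f : continuous f ->
  prim f 0 = 0 /\ forall x, is_derive x 1 (prim f) (f x).
Proof.
move=> cf; rewrite /prim; set A := [set _ | _].
exact: (@xgetPex _ (cst 0) A (ex_primitive cf)).
Qed.

Lemma prim0 f : continuous f -> prim f 0 = 0.
Proof. by move=> /primP[]. Qed.

Lemma is_derive_prim f : continuous f ->
  forall x, is_derive x 1 (prim f) (f x).
Proof. by move=> /primP[]. Qed.

Lemma continuous_prim f : continuous f -> continuous (prim f).
Proof.
by move=> cf x; apply: is_derive1_continuous; exact: is_derive_prim.
Qed.

Lemma dist_prim f g a x : continuous f -> continuous g -> 0 <= x ->
  (forall z, 0 <= z <= x -> `|f z - g z| <= a) ->
  `|prim f x - prim g x| <= a * x.
Proof.
move=> cf cg x0 fga.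
have := @dist_derive_le (fun z => prim f z - prim g z) (fun z => f z - g z)
  0 x a x0 _ fga.
rewrite !prim0// !subr0; apply => z _.
by have := is_derive_prim cf z; have := is_derive_prim cg z => ? ?;
  exact: is_deriveB.
Qed.

End calculus.

(** * Absolutely continuous functions *)

Section absolutely_continuous.
Context {R : realType}.
Implicit Types (f g : R -> R) (a b x y : R).

Local Notation mu := (@lebesgue_measure R).

Lemma abs_continuousW a b y f : y <= b -> abs_continuous a b f ->
  abs_continuous a y f.
Proof.
move=> yb fac e /fac[del del0 fe]; exists del => // n p q pq.
by apply: fe => i; have [? ? qy] := pq i; split=> //; exact: le_trans yb.
Qed.

(** Converts the inclusion of ordered intervals in a small open set into the bound on total length
    that absolute continuity asks for. *)
Lemma sum_itv_le_measure n (p q : nat -> R) (U : set R) : measurable U ->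
  (forall i, (i < n)%N -> p i <= q i /\ `]p i, q i[ `<=` U) ->
  (forall i j, (i < j < n)%N -> q i <= p j) ->
  ((\sum_(i < n) (q i - p i))%:E <= mu U)%E.
Proof.
move=> mU pqU qp.
have mpq : forall k : nat, measurable (`]p k, q k[%classic : set R).
  by move=> k; exact: measurable_itv.
rewrite -sumEFin.
have -> : (\sum_(i < n) (q i - p i)%:E = \sum_(i < n) mu `]p i, q i[)%E.
  apply: eq_bigr => i _; rewrite lebesgue_measure_itv/= lte_fin.
  have [//|qpi] := ltP (p i) (q i).
  have [pqi _] := pqU i (ltn_ord i).
  suff -> : q i = p i by rewrite subrr.
  by apply/eqP; rewrite eq_le qpi.
rewrite -(@measure_semi_additive_ord_I _ _ _ mu (fun i => `]p i, q i[%classic))//.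
- apply: le_measure; rewrite ?inE//; first exact: bigsetU_measurable.
  rewrite -(bigcup_mkord n (fun i => `]p i, q i[%classic)) => x [i /= ni]; exact: (pqU i ni).2.
- apply/trivIsetP => i j /= ni nj ij; apply/seteqP; split=> // x /=.
  rewrite !in_itv/= => -[/andP[pi iq] /andP[pj jq]].
  have [ltij|ltji|eqij] := ltngtP i j; last by rewrite eqij eqxx in ij.
  + have := qp i j; rewrite ltij nj => /(_ isT) ?; lra.
  + have := qp j i; rewrite ltji ni => /(_ isT) ?; lra.
- exact: bigsetU_measurable.
Qed.

Lemma derive0_dist f x (e : R) : is_derive x 1 f 0 -> 0 < e ->
  exists2 r, 0 < r & forall y, `|y - x| < r -> `|f y - f x| <= e * `|y - x|.
Proof.
move=> [dfx f'0] e0.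
have : \forall h \near 0^', `|'D_1 f x - h^-1 *: (f (h *: 1 + x) - f x)| <= e.
  by have /cvgrPdist_le := dfx; apply.
rewrite f'0.
rewrite near_withinE => -[r /= r0 re]; exists r => // y yr.
have [->|yx] := eqVneq y x; first by rewrite !subrr normr0 mulr0.
have /= := re (y - x); rewrite sub0r normrN => /(_ yr).
rewrite subr_eq0 => /(_ yx).
rewrite sub0r normrN /GRing.scale/= mulr1 subrK normrM normfV.
by rewrite ler_pdivrMl ?normr_gt0 ?subr_eq0// mulrC.
Qed.

(* A Cousin-type argument: the sets [`[a, x]] that can be cut into finitely many
   intervals which either lie in a small neighbourhood of the exceptional null
   set, or on which [f] varies by at most [e] times the length, exhaust
   [`[a, b]]. *)
Lemma abs_continuous_ae_derive0 a b f : a <= b -> abs_continuous a b f ->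
  {ae mu, forall x, x \in `]a, b[ -> is_derive x 1 f 0} -> f b = f a.
Proof.
move=> ab fac [E [mE muE0 fE]].
suff small (e : R) : 0 < e -> `|f b - f a| <= e.
  apply/eqP; rewrite -subr_eq0 -normr_le0; apply/ler_addgt0Pr => e e0.
  by rewrite add0r; exact: small.
move=> e0.
(* Half of [e] is reserved for the derivative estimate over the length [b - a]; the [+ 1] keeps the
   denominator positive when [a = b]. *)
pose e' := e / (2 * (b - a + 1)).
have e'0 : 0 < e' by rewrite divr_gt0//; lra.
have e2 : 0 < e / 2 by lra.
have [del del0 fdel] := fac (e / 2) e2.
(* The derivative is known only inside the open interval, so the endpoints join the exceptional null
   set. *)
pose E1 : set R := E `|` [set a; b].
have mE1 : measurable E1 by apply: measurableU => //; exact: measurableU.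
have muE1 : mu E1 = 0%E.
  apply: measure_negligible => //; apply: negligibleU; first exact/negligibleP.
  by apply: negligibleU; apply/negligibleP => //; exact: lebesgue_measure_set1.
have [|U [oU EU muU]] := @lebesgue_regularity_outer R E1 del mE1 _ del0.
  by rewrite [X in (X < _)%E]muE1.
have mU : measurable U by exact: measurable_realfun.open_measurable.
have {}muU : (mu U < del%:E)%E.
  have : (mu U <= mu E1 + mu (U `\` E1))%E.
    rewrite -{1}(setDUK EU) measureU2//; exact: measurableD.
  by rewrite muE1 add0e => /le_lt_trans; apply.
pose A x := exists (n : nat) (p q : nat -> R),
  [/\ forall i, (i < n)%N -> [/\ a <= p i, p i <= q i, q i <= x &
                                `]p i, q i[ `<=` U],
      forall i j, (i < j < n)%N -> q i <= p j &
      `|f x - f a| <= e' * (x - a) + \sum_(i < n) `|f (q i) - f (p i)| ].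
pose S := [set x | a <= x <= b /\ A x].
have Sa : S a.
  split; first by rewrite lexx.
  by exists 0%N, (cst 0), (cst 0); split=> //; rewrite ?big_ord0 ?subrr ?normr0 ?mulr0 ?addr0.
have ubS : has_ubound S by exists b => x [/andP[]].
have supS : has_sup S by split=> //; exists a.
set c := sup S.
have ac : a <= c by exact: ub_le_sup.
have cb : c <= b by apply: ge_sup; [exists a|move=> x [/andP[]]].
(* Extension across the supremum [c]: if [c] is exceptional, []x, y[] is appended as one more
   interval inside [U]; otherwise the zero derivative at [c] pays for the passage from [x] to
   [y]. *)
have [r r0 step] : exists2 r, 0 < r & forall x y, a <= x -> x <= c -> c <= y ->
    y <= b -> c - r < x -> y < c + r -> A x -> A y.
  have [cE|cE] := pselect (E1 c).
    have := oU; rewrite openE => /(_ _ (EU _ cE)) [r /= r0 rU].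
    exists r => // x y ax xc cy yb cx yc [n [p [q [pq qp fx]]]].
    exists n.+1, (fun i => if (i < n)%N then p i else x),
      (fun i => if (i < n)%N then q i else y); split.
    + move=> i; rewrite ltnS leq_eqVlt => /predU1P[->|ni].
        rewrite ltnn; split=> //; first lra.
        move=> z /=; rewrite in_itv/= => /andP[xz zy]; apply: rU => /=.
        by rewrite ltr_norml; lra.
      rewrite ni; have [? ? ? ?] := pq _ ni; split=> //; lra.
    + move=> i j /andP[ij]; rewrite ltnS leq_eqVlt => /predU1P[jn|jn].
        by rewrite -jn ij jn ltnn; have [] := pq i; rewrite // -jn.
      by rewrite jn (ltn_trans ij jn); apply: qp; rewrite ij.
    + rewrite big_ord_recr/= ltnn.
      under eq_bigr do rewrite ltn_ord.
      have -> : f y - f a = (f x - f a) + (f y - f x) by lra.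
      rewrite (le_trans (ler_normD _ _))//.
      have : e' * (x - a) <= e' * (y - a) by rewrite ler_pM2l//; lra.
      by lra.
  have a_c : a < c.
    by rewrite lt_neqAle ac andbT; apply/eqP => eqc; apply: cE; right; left.
  have c_b : c < b.
    by rewrite lt_neqAle cb andbT; apply/eqP => eqc; apply: cE; right; right.
  have fc : is_derive c 1 f 0.
    apply: contrapT => nfc; apply: cE; left; apply: fE => /= fc.
    by apply: nfc; apply: fc; rewrite in_itv/= a_c.
  have [r r0 rf] := derive0_dist fc e'0.
  exists r => // x y ax xc cy yb cx yc [n [p [q [pq qp fx]]]].
  exists n, p, q; split=> //.
    by move=> i /pq[? ? ? ?]; split=> //; lra.
  have -> : f y - f a = (f x - f a) + ((f y - f c) - (f x - f c)) by lra.
  have yfc : `|f y - f c| <= e' * (y - c).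
    by have := rf y; rewrite ger0_norm ?subr_ge0//; apply; lra.
  have xfc : `|f x - f c| <= e' * (c - x).
    by have := rf x; rewrite ler0_norm ?subr_le0// opprB; apply; lra.
  rewrite (le_trans (ler_normD _ _))//.
  have := ler_normB (f y - f c) (f x - f c).
  have -> : e' * (y - a) = e' * (x - a) + e' * (y - c) + e' * (c - x) by ring.
  by lra.
have [x [/andP[ax xb] Ax] cx] := sup_adherent r0 supS.
rewrite -/c in cx.
have xc : x <= c by apply: ub_le_sup => //; split=> //; rewrite ax.
(* A point beyond [c], unless [c] is already [b]. As it is shown to lie in [S], it cannot exceed
   [c], so it must be [b]. *)
pose y := Num.min b (c + r / 2).
have yE : y <= b /\ y <= c + r / 2 /\ (y = b \/ c + r / 2 <= y).
  by rewrite /y minEle; case: (leP b (c + r / 2)) => ?;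
    rewrite ?lexx; split=> //; [split=> //; left|exact: ltW|split=> //; right].
have [yb [ycr y_or]] := yE.
have cy : c <= y by case: y_or => [->//|]; lra.
have Ay : A y by apply: (step x) => //; lra.
have yc : y <= c by apply: ub_le_sup => //; split=> //; rewrite yb andbT; lra.
have {}yb : y = b by case: y_or => //; lra.
have [n [p [q [pq qp fb]]]] : A b by rewrite -yb.
have sumpq : \sum_(i < n) (q i - p i) < del.
  rewrite -lte_fin (le_lt_trans _ muU)// sum_itv_le_measure//.
  by move=> i /pq[].
have /fdel fpq : forall i : 'I_n, [/\ a <= p i, p i <= q i & q i <= b].
  by move=> i; have [] := pq i (ltn_ord i).
have : \sum_(i < n) `|f (q i) - f (p i)| < e / 2.
  apply: fpq => //; apply/trivIsetP => i j _ _ ij.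
  apply/seteqP; split=> // z /=; rewrite !in_itv/= => -[/andP[? ?] /andP[? ?]].
  have [ltij|ltji|/val_inj eqij] := ltngtP i j; last by rewrite eqij eqxx in ij.
    by have := qp i j; rewrite ltij ltn_ord => /(_ isT) ?; lra.
  by have := qp j i; rewrite ltji ltn_ord => /(_ isT) ?; lra.
suff : e' * (b - a) <= e / 2 by lra.
rewrite /e' mulrAC ler_pdivrMr; last lra.
have : 0 <= e * (b - a) by rewrite mulr_ge0//; lra.
by lra.
Qed.

End absolutely_continuous.

(** * The shooting problem *)

Section shooting.
Context {R : realType}.
Variable L : R.
Hypothesis L0 : 0 < L.
Implicit Types (s y u : R -> R) (l x z : R).

(** With [u] in the role of the quasi-derivative, the eigenvalue equation becomes a first-order
    linear system that contains [s] but not its derivative, so a merely continuous [s] is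
    allowed. *)
Definition odey s y u x : R := u x + s x * y x.
Definition odeu s l y u x : R := - s x * u x - (s x ^+ 2 + l) * y x.

Definition ode s l y u := forall x, 0 <= x <= L ->
  is_derive x 1 y (odey s y u x) /\ is_derive x 1 u (odeu s l y u x).

Definition shooting s l y u :=
  [/\ continuous y, continuous u, y 0 = 0, u 0 = 1 & ode s l y u].

(** Projection onto [[0, L]]. Composing with it extends a function from the interval to a continuous
    function on the line, as [prim] requires, and freezes Brownian motion outside its time set. *)
Definition clamp x : R := Num.max 0 (Num.min x L).

Lemma clamp_itv x : 0 <= clamp x <= L.
Proof. by rewrite /clamp le_max lexx/= ge_max ge_min lexx orbT andbT ltW. Qed.

Lemma clampE x : 0 <= x <= L -> clamp x = x.
Proof.
by move=> /andP[x0 xL]; rewrite /clamp (min_idPl xL); exact/max_idPr.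
Qed.

Lemma clamp_dist x z : `|clamp x - clamp z| <= `|x - z|.
Proof.
have clampP t : [\/ t < 0 /\ clamp t = 0, 0 <= t <= L /\ clamp t = t |
                  L < t /\ clamp t = L].
  have [t0|t0] := ltP t 0.
    constructor 1; split=> //; rewrite /clamp (min_idPl _).
      by apply/max_idPl; exact: ltW.
    by rewrite ltW// (lt_trans t0).
  have [tL|tL] := leP t L; first by constructor 2; rewrite clampE ?t0.
  constructor 3; split=> //; rewrite /clamp (min_idPr (ltW tL)).
  by apply/max_idPr; exact: ltW.
have := ler_norm (x - z); have := ler_norm (z - x); rewrite (distrC z).
rewrite ler_norml; have := L0.
by case: (clampP x) => -[? ->]; case: (clampP z) => -[? ->]; lra.
Qed.

Lemma continuous_clamp : continuous clamp.
Proof.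
move=> x; apply/cvgrPdist_le => e e0; exists e => //= z xz.
by rewrite (le_trans (clamp_dist _ _))// ltW.
Qed.

(** The product of [e + k] with exp(- C x) is nonincreasing. The offset [k] absorbs a constant
    forcing term; [k = 0] serves for bounds and uniqueness. *)
Lemma gronwall (e de : R -> R) (C k : R) :
  (forall x, 0 <= x <= L -> is_derive x 1 e (de x)) ->
  (forall x, 0 <= x <= L -> de x <= C * (e x + k)) ->
  forall x, 0 <= x <= L -> e x + k <= (e 0 + k) * expR (C * x).
Proof.
move=> eE deC x /andP[x0 xL].
pose f z := - ((e z + k) * expR (- (C * z))).
pose df z := (C * (e z + k) - de z) * expR (- (C * z)).
have fE z : 0 <= z <= x -> is_derive z 1 f (df z).
  move=> /andP[z0 zx].
  have ? : is_derive z 1 e (de z) by apply: eE; rewrite z0 (le_trans zx).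
  apply: is_derive_eq.
  rewrite /df /GRing.scale/=; ring.
have : f 0 <= f x.
  apply: (nondecreasing_derive x0 fE) => z /andP[z0 zx].
  by rewrite mulr_ge0 ?expR_ge0// subr_ge0 deC// z0 (le_trans zx).
rewrite /f mulr0 oppr0 expR0 mulr1 lerN2 expRN.
by rewrite ler_pdivrMr ?expR_gt0.
Qed.

Let cross_le (T t p q : R) : `|t| <= T -> 2 * t * p * q <= T * (p ^+ 2 + q ^+ 2).
Proof.
rewrite ler_norml => /andP[? ?]; rewrite -subr_ge0.
have -> : T * (p ^+ 2 + q ^+ 2) - 2 * t * p * q =
  (T - t) / 2 * (p + q) ^+ 2 + (T + t) / 2 * (p - q) ^+ 2 by field.
by rewrite addr_ge0// mulr_ge0 ?sqr_ge0//; lra.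
Qed.

Let young (p q m : R) : `|q| <= m -> 2 * p * q <= p ^+ 2 + m ^+ 2.
Proof.
move=> qm; have : q ^+ 2 <= m ^+ 2.
  by rewrite -real_normK ?num_real// lerXn2r// ?nnegrE// (le_trans _ qm).
have : 0 <= (p - q) ^+ 2 by exact: sqr_ge0.
have -> : (p - q) ^+ 2 = p ^+ 2 + q ^+ 2 - 2 * p * q by ring.
by lra.
Qed.

(** The left side is the derivative of p^2 + q^2 along the system and equals 2 s p^2 - 2 s q^2 + 2
    (1 - s^2 - l) p q: the squares cost [2 * S], the mixed term costs [1 + S ^+ 2 + S] by
    [cross_le]. *)
Let main_le (S s l p q : R) : `|s| <= S -> `|l| <= S ->
  2 * p * (q + s * p) + 2 * q * (- s * q - (s ^+ 2 + l) * p) <=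
  (1 + 3 * S + S ^+ 2) * (p ^+ 2 + q ^+ 2).
Proof.
move=> sS lS.
have sS2 : `|s ^+ 2| <= S ^+ 2.
  by rewrite normrX lerXn2r// ?nnegrE// (le_trans _ sS).
have := @cross_le (1 + S ^+ 2 + S) (1 - s ^+ 2 - l) p q.
have -> : `|1 - s ^+ 2 - l| <= 1 + S ^+ 2 + S.
  rewrite (le_trans (ler_normB _ _))// lerD//.
  by rewrite (le_trans (ler_normB _ _))// normr1 lerD.
move=> /(_ isT).
move: sS; rewrite ler_norml => /andP[? ?].
have : 0 <= 2 * (S - s) * p ^+ 2 by rewrite mulr_ge0 ?sqr_ge0//; lra.
have : 0 <= 2 * (S + s) * q ^+ 2 by rewrite mulr_ge0 ?sqr_ge0//; lra.
by lra.
Qed.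

Let sqr_sum_derive (p q : R -> R) (dp dq z : R) :
  is_derive z 1 p dp -> is_derive z 1 q dq ->
  is_derive z 1 (fun x => p x ^+ 2 + q x ^+ 2) (2 * p z * dp + 2 * q z * dq).
Proof.
by move=> ? ?; apply: is_derive_eq; rewrite /GRing.scale/=; ring.
Qed.

Lemma shooting_bound S : exists2 M, 1 <= M & forall s l y u,
  (forall x, 0 <= x <= L -> `|s x| <= S) -> `|l| <= S -> shooting s l y u ->
  forall x, 0 <= x <= L -> `|y x| <= M /\ `|u x| <= M.
Proof.
pose C := 1 + 3 * S + S ^+ 2.
(* A bound on |p| follows from 2 |p| <= 1 + p^2, which avoids square roots and makes the final [M]
   at least 1. *)
have sqr_bd (e : R) : 0 <= e -> forall p q : R,
    p ^+ 2 + q ^+ 2 <= e -> `|p| <= 1 + e.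
  move=> e0 p q pqe; have := sqr_ge0 q; have := @young 1 p `|p| (lexx _).
  have := @young 1 (- p) `|p|; rewrite normrN => /(_ (lexx _)).
  have p2 : `|p| ^+ 2 = p ^+ 2 by rewrite real_normK// num_real.
  by rewrite p2 ler_norml => ? ? ?; lra.
exists (1 + expR (`|C| * L)); first by rewrite lerDl expR_ge0.
move=> s l y u sS lS [_ _ y0 u0 yu] x xL.
pose e z := y z ^+ 2 + u z ^+ 2.
have : e x + 0 <= (e 0 + 0) * expR (C * x).
  apply: (@gronwall e (fun x => 2 * y x * odey s y u x + 2 * u x * odeu s l y u x)) => //.
    by move=> z /yu[? ?]; exact: sqr_sum_derive.
  by move=> z /sS sz; rewrite addr0; exact: main_le.
rewrite !addr0 /e y0 u0 expr0n expr1n add0r mul1r => eC.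
have {}eC : y x ^+ 2 + u x ^+ 2 <= expR (`|C| * L).
  rewrite (le_trans eC)// ler_expR; move: xL => /andP[x0 xL].
  by rewrite (@le_trans _ _ (`|C| * x))// ?ler_wpM2r ?ler_norm// ler_wpM2l.
split; first by apply: sqr_bd eC; rewrite expR_ge0.
by apply: (sqr_bd _ _ _ (y x)); rewrite ?expR_ge0// addrC.
Qed.

Lemma ode_eq0 S s l y u : (forall x, 0 <= x <= L -> `|s x| <= S) -> `|l| <= S ->
  ode s l y u -> y 0 = 0 -> u 0 = 0 -> forall x, 0 <= x <= L -> y x = 0.
Proof.
move=> sS lS yu y0 u0 x xL.
have : (y x ^+ 2 + u x ^+ 2) + 0 <=
    ((y 0 ^+ 2 + u 0 ^+ 2) + 0) * expR ((1 + 3 * S + S ^+ 2) * x).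
  apply: (@gronwall (fun x => y x ^+ 2 + u x ^+ 2)
    (fun x => 2 * y x * odey s y u x + 2 * u x * odeu s l y u x)) => //.
    by move=> z /yu[? ?]; exact: sqr_sum_derive.
  by move=> z /sS sz; rewrite addr0; exact: main_le.
rewrite y0 u0 expr0n !addr0 mul0r => yu0.
apply/eqP; rewrite -sqrf_eq0 eq_le sqr_ge0 andbT.
by rewrite (le_trans _ yu0)// lerDl sqr_ge0.
Qed.

(** The difference of two solutions starts at 0 and solves the first system with a forcing
    proportional to [h]; Gronwall with offset [h ^+ 2] bounds its square by a multiple of [h ^+ 2].
    As [A] depends only on [S] and [L], it serves all pairs at once. *)
Lemma shooting_lipschitz S : exists2 A, 0 <= A & forall s s' l l' y u y' u' h,
  (forall x, 0 <= x <= L -> `|s x| <= S) -> `|l| <= S ->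
  (forall x, 0 <= x <= L -> `|s' x| <= S) -> `|l'| <= S ->
  (forall x, 0 <= x <= L -> `|s x - s' x| <= h) -> `|l - l'| <= h ->
  shooting s l y u -> shooting s' l' y' u' ->
  forall x, 0 <= x <= L -> `|y x - y' x| <= A * h /\ `|u x - u' x| <= A * h.
Proof.
have [M M1 yM] := shooting_bound S.
(* The free growth rate of [main_le], then 1 from Young's inequality, then the squared amplitudes of
   the forcing per unit of [h]: [M] in the equation for [y], [(2 * S + 2) * M] in the one for
   [u]. *)
pose C := (1 + 3 * S + S ^+ 2) + 1 + (M ^+ 2 + ((2 * S + 2) * M) ^+ 2).
exists (expR (`|C| * L)); first exact: expR_ge0.
move=> s s' l l' y u y' u' h sS lS s'S l'S ss' ll' yu yu'.
have yM' := yM _ _ _ _ s'S l'S yu'.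
have [_ _ y0 u0 {}yu] := yu; have [_ _ y'0 u'0 {}yu'] := yu'.
move=> x xL.
have h0 : 0 <= h by rewrite (le_trans _ ll').
have S0 : 0 <= S by rewrite (le_trans _ lS).
pose p z := y z - y' z; pose q z := u z - u' z.
pose dp z := odey s y u z - odey s' y' u' z.
pose dq z := odeu s l y u z - odeu s' l' y' u' z.
pose e z := p z ^+ 2 + q z ^+ 2.
have : e x + h ^+ 2 <= (e 0 + h ^+ 2) * expR (C * x).
  apply: (@gronwall e (fun x => 2 * p x * dp x + 2 * q x * dq x)) => //.
    move=> z zL; have [? ?] := yu z zL; have [? ?] := yu' z zL.
    have ? : is_derive z 1 p (dp z) by exact: is_deriveB.
    have ? : is_derive z 1 q (dq z) by exact: is_deriveB.
    exact: sqr_sum_derive.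
  move=> z zL; have [y'M u'M] := yM' z zL.
  have := @main_le S (s z) l (p z) (q z) (sS z zL) lS.
  (* [v] is the difference of the coefficients s^2 + l of the two systems. *)
  pose w := s z - s' z; pose v := w * (s z + s' z) + (l - l').
  have wh : `|w| <= h := ss' z zL.
  have wyM : `|w * y' z| <= h * M by rewrite normrM ler_pM.
  have r2 : `|- (w * u' z + v * y' z)| <= h * ((2 * S + 2) * M).
    rewrite normrN (le_trans (ler_normD _ _))//.
    have : `|w * u' z| <= h * M by rewrite normrM ler_pM.
    have : `|v * y' z| <= (h * (2 * S) + h) * M.
      rewrite normrM ler_pM// (le_trans (ler_normD _ _))// lerD// normrM ler_pM//.
      by rewrite (le_trans (ler_normD _ _))//; have := sS z zL; have := s'S z zL; lra.
    by lra.
  have := @young (p z) _ _ wyM; have := @young (q z) _ _ r2.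
  have : 0 <= (M ^+ 2 + ((2 * S + 2) * M) ^+ 2) * e z.
    by rewrite mulr_ge0// addr_ge0 ?sqr_ge0.
  have : 0 <= (1 + 3 * S + S ^+ 2 + 1) * h ^+ 2.
    by rewrite mulr_ge0 ?sqr_ge0//; have := sqr_ge0 S; lra.
  have -> : 2 * p z * dp z + 2 * q z * dq z =
    (2 * p z * (q z + s z * p z) +
     2 * q z * (- s z * q z - (s z ^+ 2 + l) * p z)) +
    2 * p z * (w * y' z) + 2 * q z * (- (w * u' z + v * y' z)).
    rewrite /dp /dq /odey /odeu /v /w /p /q.
    by move: (s z) (s' z) (y z) (y' z) (u z) (u' z) => *; ring.
  rewrite /C /e.
  move: (p z) (q z) (dp z) (dq z) (w * y' z) (w * u' z + v * y' z) => *; lra.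
rewrite {2}/e /p /q y0 u0 y'0 u'0 !subrr expr0n !add0r => eC.
pose A := expR (`|C| * L).
have A1 : 1 <= A.
  by rewrite -[leLHS]expR0 ler_expR mulr_ge0// ltW.
have {}eC : e x <= (A * h) ^+ 2.
  have CA : expR (C * x) <= A.
    rewrite ler_expR; move: xL => /andP[x0 xL].
    by rewrite (@le_trans _ _ (`|C| * x))// ?ler_wpM2r ?ler_norm// ler_wpM2l.
  have : h ^+ 2 * expR (C * x) <= h ^+ 2 * A by rewrite ler_wpM2l ?sqr_ge0.
  have : h ^+ 2 * A <= h ^+ 2 * A ^+ 2.
    by rewrite ler_wpM2l ?sqr_ge0// expr2 ler_peMl// (le_trans _ A1).
  by have := sqr_ge0 h; rewrite exprMn; lra.
have Ah0 : 0 <= A * h by rewrite mulr_ge0// (le_trans _ A1).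
have norm_le (a b : R) : a ^+ 2 + b ^+ 2 <= (A * h) ^+ 2 -> `|a| <= A * h.
  move=> ab; rewrite -(@ler_pXn2r _ 2)// ?nnegrE// real_normK ?num_real//.
  by have := sqr_ge0 b; lra.
by split; [exact: norm_le eC|apply: (norm_le _ (p x)); rewrite addrC].
Qed.

End shooting.

(** * Existence of shooting solutions by Picard iteration *)

Section existence.
Context {R : realType}.
Variable L : R.
Hypothesis L0 : 0 < L.
Implicit Types (s y u : R -> R) (l x z : R).

Lemma continuous_bounded s : continuous s ->
  exists2 S, 0 <= S & forall x, 0 <= x <= L -> `|s x| <= S.
Proof.
move=> cs.
have cns : {within `[0, L], continuous (fun x => `|s x|)}.
  apply: continuous_subspaceT => x.
  by apply: continuous_comp; [exact: cs|exact: norm_continuous].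
have [c _ cmax] := EVT_max (ltW L0) cns.
by exists `|s c| => // x xL; apply: cmax; rewrite in_itv.
Qed.

(** The intervals of centre [v n] and radius [r n] are nested, because [r n] dominates the next step
    plus [r n.+1]; the limit is the supremum of their left ends and the error bound is explicit. *)
Lemma geometric_cvg (v : nat -> R) (M : R) :
  (forall n, `|v n.+1 - v n| <= M * 2^-1 ^+ n) ->
  exists l, forall n, `|v n - l| <= 2 * M * 2^-1 ^+ n.
Proof.
move=> vM; pose r n : R := 2 * M * 2^-1 ^+ n.
have r0 n : 0 <= r n.
  have := le_trans (normr_ge0 _) (vM n); rewrite /r => ?.
  by rewrite -mulrA mulr_ge0.
have rS n : M * 2^-1 ^+ n + r n.+1 <= r n by rewrite /r exprS; lra.
have lo : nondecreasing_seq (fun n => v n - r n).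
  apply/nondecreasing_seqP => n.
  by have := vM n; rewrite ler_norml => /andP[? ?]; have := rS n; lra.
have hi : nonincreasing_seq (fun n => v n + r n).
  apply/nonincreasing_seqP => n.
  by have := vM n; rewrite ler_norml => /andP[? ?]; have := rS n; lra.
have lohi m n : v m - r m <= v n + r n.
  have := lo m (maxn m n) (leq_maxl _ _).
  have := hi n (maxn m n) (leq_maxr _ _).
  by have := r0 (maxn m n); lra.
exists (sup (range (fun n => v n - r n))) => n.
rewrite -/(r n) ler_distl; apply/andP; split.
  rewrite lerBlDr; apply: ge_sup; first by exists (v 0%N - r 0%N); exists 0%N.
  by move=> _ [m _ <-]; exact: lohi.
rewrite -lerBlDr; apply: ub_le_sup; last by exists n.
by exists (v 0%N + r 0%N) => _ [m _ <-]; exact: lohi.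
Qed.

Lemma geometric_small (M e : R) : 0 < e -> exists n, M * 2^-1 ^+ n <= e.
Proof.
move=> e0; have h2 : `|2^-1 : R| < 1 by rewrite ger0_norm; lra.
have := cvg_geometric M h2.
move/cvgrPdist_le => /(_ e e0)[n _ /(_ n (leqnn n))/= ne].
exists n; move: ne; rewrite sub0r normrN => /(le_trans _); apply.
exact: ler_norm.
Qed.

Lemma uniform_limit_continuous_geometric (f : nat -> R -> R) (g : R -> R) M :
  (forall n, continuous (f n)) ->
  (forall n x, `|f n x - g x| <= M * 2^-1 ^+ n) -> continuous g.
Proof.
move=> cf fg x; apply/cvgrPdist_le => e e0.
have [n nM] : exists n, M * 2^-1 ^+ n <= e / 3.
  by apply: geometric_small; lra.
have : \forall z \near x, `|f n x - f n z| <= e / 3.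
  by have /cvgrPdist_le := cf n x; apply; lra.
apply: filterS => z xz.
have -> : g x - g z = (f n x - f n z) - (f n x - g x) + (f n z - g z) by ring.
rewrite (le_trans (ler_normD _ _))//.
have := ler_normB (f n x - f n z) (f n x - g x).
have := fg n x; have := fg n z; lra.
Qed.

Lemma dist_le_derive (f df g dg : R -> R) x : 0 <= x -> f 0 = 0 -> 0 <= g 0 ->
  (forall z, 0 <= z <= x -> is_derive z 1 f (df z)) ->
  (forall z, 0 <= z <= x -> is_derive z 1 g (dg z)) ->
  (forall z, 0 <= z <= x -> `|df z| <= dg z) -> `|f x| <= g x.
Proof.
move=> x0 f0 g0 fE gE fg.
have gf : 0 <= g x - f x.
  have := @nondecreasing_derive R (fun z => g z - f z) (fun z => dg z - df z) 0 x x0.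
  rewrite f0 subr0 => H; apply: (le_trans g0); apply: H => z zx.
    by have := fE z zx; have := gE z zx => ? ?; exact: is_deriveB.
  by have := fg z zx; rewrite ler_norml => /andP[? ?]; lra.
have gf' : 0 <= g x + f x.
  have := @nondecreasing_derive R (fun z => g z + f z) (fun z => dg z + df z) 0 x x0.
  rewrite f0 addr0 => H; apply: (le_trans g0); apply: H => z zx.
    by have := fE z zx; have := gE z zx => ? ?; exact: is_deriveD.
  by have := fg z zx; rewrite ler_norml => /andP[? ?]; lra.
by rewrite ler_norml; lra.
Qed.

Variables (s : R -> R) (l : R).
Hypothesis cs : continuous s.

Lemma continuous_odey y u : continuous y -> continuous u ->
  continuous (odey s y u).
Proof. by move=> cy cu x; apply: cvgD; [exact: cu|apply: cvgM; [exact: cs|exact: cy]]. Qed.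

Lemma continuous_odeu y u : continuous y -> continuous u ->
  continuous (odeu s l y u).
Proof.
move=> cy cu x; apply: cvgB; apply: cvgM.
- by apply: cvgN; exact: cs.
- exact: cu.
- by apply: cvgD; [apply: cvgM; exact: cs|exact: cvg_cst].
- exact: cy.
Qed.

Fixpoint picard n : (R -> R) * (R -> R) :=
  if n is n'.+1 then
    (prim (odey s (picard n').1 (picard n').2),
     fun x => 1 + prim (odeu s l (picard n').1 (picard n').2) x)
  else (cst 0, cst 1).

Lemma continuous_picard n :
  continuous (picard n).1 /\ continuous (picard n).2.
Proof.
elim: n => [|n [cy cu]] /=; first by split=> x; exact: cvg_cst.
have cy' := continuous_odey cy cu; have cu' := continuous_odeu cy cu.
split; first exact: continuous_prim.
by move=> x; apply: cvgD; [exact: cvg_cst|exact: continuous_prim].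
Qed.

Let C S := 1 + S + S ^+ 2 + `|l|.

Lemma ode_field_dist S (y u y' u' : R -> R) z (m : R) : 0 <= S -> `|s z| <= S ->
  `|y z - y' z| <= m -> `|u z - u' z| <= m ->
  `|odey s y u z - odey s y' u' z| <= C S * m /\
  `|odeu s l y u z - odeu s l y' u' z| <= C S * m.
Proof.
move=> S0 sS ym um; have m0 : 0 <= m by rewrite (le_trans _ ym).
have Sm : 0 <= S * m by rewrite mulr_ge0.
have SSm : 0 <= S ^+ 2 * m by rewrite mulr_ge0 ?sqr_ge0.
have lm : 0 <= `|l| * m by rewrite mulr_ge0.
have sym : `|s z * (y z - y' z)| <= S * m by rewrite normrM ler_pM.
have sum : `|s z * (u z - u' z)| <= S * m by rewrite normrM ler_pM.
have sslm : `|(s z ^+ 2 + l) * (y z - y' z)| <= (S ^+ 2 + `|l|) * m.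
  rewrite normrM ler_pM// (le_trans (ler_normD _ _))// lerD//.
  by rewrite normrX lerXn2r// ?nnegrE.
rewrite /odey /odeu /C; split.
  have -> : u z + s z * y z - (u' z + s z * y' z) =
    (u z - u' z) + s z * (y z - y' z) by ring.
  by rewrite (le_trans (ler_normD _ _))//; lra.
have -> : - s z * u z - (s z ^+ 2 + l) * y z -
    (- s z * u' z - (s z ^+ 2 + l) * y' z) =
  - (s z * (u z - u' z)) - (s z ^+ 2 + l) * (y z - y' z) by ring.
by rewrite (le_trans (ler_normB _ _))// normrN; lra.
Qed.

(** Against the weight exp(2 C x), integrating a field with Lipschitz constant C gains a factor 1/2:
    [C S * g n] is the derivative of [g n.+1]. Convergence therefore holds on all of [[0, L]],
    however large [L] is. *)
Lemma picard_dist : exists K : R, forall n x, 0 <= x <= L ->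
  `|(picard n.+1).1 x - (picard n).1 x| <= K * 2^-1 ^+ n /\
  `|(picard n.+1).2 x - (picard n).2 x| <= K * 2^-1 ^+ n.
Proof.
have [S S0 sS] := continuous_bounded cs.
have C0 : 0 <= C S by rewrite !addr_ge0 ?sqr_ge0.
pose g n x := expR (2 * C S * x) * 2^-1 ^+ n.
exists (expR (2 * C S * L)) => n x xL.
suff [gy gu] : `|(picard n.+1).1 x - (picard n).1 x| <= g n x /\
    `|(picard n.+1).2 x - (picard n).2 x| <= g n x.
  have gL : g n x <= expR (2 * C S * L) * 2^-1 ^+ n.
    rewrite /g ler_wpM2r// ?exprn_ge0 ?invr_ge0// ler_expR ler_wpM2l ?mulr_ge0//.
    by case/andP: xL.
  by split; [exact: le_trans gL|exact: le_trans gL].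
have gE k z : is_derive z 1 (g k.+1) (C S * g k z).
  rewrite /g; apply: is_derive_eq; rewrite /GRing.scale/= exprS; lra.
have g0 k z : 0 <= g k z by rewrite /g mulr_ge0 ?expR_ge0// exprn_ge0// invr_ge0.
elim: n x xL => [|n IH] x xL.
  have g1 z : 0 <= z -> C S * z <= g 0%N z.
    move=> z0; rewrite /g expr0 mulr1 (le_trans _ (expR_ge1Dx _))//.
    have : 0 <= C S * z by rewrite mulr_ge0.
    by lra.
  have C1 : 1 <= C S.
    by rewrite /C -!addrA lerDl !addr_ge0 ?sqr_ge0.
  have [x0 _] := andP xL.
  have cc (c : R) : continuous (cst c : R -> R) by move=> z; exact: cvg_cst.
  have czx z : 0 <= z <= x -> 0 <= z <= L.
    by move=> /andP[-> zx]; rewrite (le_trans zx); case/andP: xL.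
  split; rewrite (le_trans _ (g1 _ x0))//=.
    rewrite subr0; have c1 := continuous_odey (cc 0) (cc 1).
    have := @dist_derive_le R _ _ 0 x (C S) x0 (fun z _ => is_derive_prim c1 z).
    rewrite prim0// !subr0; apply => z _.
    by rewrite /odey mulr0 addr0 normr1.
  rewrite addrAC subrr add0r; have c1 := continuous_odeu (cc 0) (cc 1).
  have := @dist_derive_le R _ _ 0 x (C S) x0 (fun z _ => is_derive_prim c1 z).
  rewrite prim0// !subr0; apply => z /czx /sS sz.
  rewrite /odeu mulr0 subr0 mulr1 normrN (le_trans sz)// /C.
  by have := sqr_ge0 S; have := normr_ge0 l; lra.
have [x0 xleL] := andP xL.
have [cy cu] := continuous_picard n; have [cy' cu'] := continuous_picard n.+1.
have gS0 : 0 <= g n.+1 0 by [].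
have field z : 0 <= z <= x ->
    `|odey s (picard n.+1).1 (picard n.+1).2 z -
      odey s (picard n).1 (picard n).2 z| <= C S * g n z /\
    `|odeu s l (picard n.+1).1 (picard n.+1).2 z -
      odeu s l (picard n).1 (picard n).2 z| <= C S * g n z.
  move=> /andP[z0 zx]; have zL : 0 <= z <= L by rewrite z0 (le_trans zx).
  by have [? ?] := IH z zL; apply: ode_field_dist => //; exact: sS.
split.
  apply: (@dist_le_derive (fun z => (picard n.+2).1 z - (picard n.+1).1 z)
    (fun z => odey s (picard n.+1).1 (picard n.+1).2 z -
              odey s (picard n).1 (picard n).2 z)
    (g n.+1) (fun z => C S * g n z) x x0) => //=.
  - by rewrite !prim0 ?subr0//; exact: continuous_odey.
  - move=> z _; have := is_derive_prim (continuous_odey cy cu) z.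
    have := is_derive_prim (continuous_odey cy' cu') z => ? ?.
    exact: is_deriveB.
  - by move=> z /field[].
have -> : (picard n.+2).2 x - (picard n.+1).2 x =
    prim (odeu s l (picard n.+1).1 (picard n.+1).2) x -
    prim (odeu s l (picard n).1 (picard n).2) x by rewrite /=; ring.
apply: (@dist_le_derive (fun z => 
    prim (odeu s l (picard n.+1).1 (picard n.+1).2) z -
    prim (odeu s l (picard n).1 (picard n).2) z)
    (fun z => odeu s l (picard n.+1).1 (picard n.+1).2 z -
              odeu s l (picard n).1 (picard n).2 z)
    (g n.+1) (fun z => C S * g n z) x x0) => //=.
- by rewrite !prim0 ?subr0//; exact: continuous_odeu.
- move=> z _; have := is_derive_prim (continuous_odeu cy cu) z.
  have := is_derive_prim (continuous_odeu cy' cu') z => ? ?.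
  exact: is_deriveB.
- by move=> z /field[].
Qed.

Lemma shooting_exists : exists y u, shooting L s l y u.
Proof.
have [K pK] := picard_dist.
have ypt x : exists a, forall n, `|(picard n).1 (clamp L x) - a| <= 2 * K * 2^-1 ^+ n.
  by apply: geometric_cvg => n; exact: (pK n _ (clamp_itv L0 x)).1.
have upt x : exists a, forall n, `|(picard n).2 (clamp L x) - a| <= 2 * K * 2^-1 ^+ n.
  by apply: geometric_cvg => n; exact: (pK n _ (clamp_itv L0 x)).2.
move/choice : ypt => [Y YE]; move/choice : upt => [U UE].
have cY : continuous Y.
  apply: (@uniform_limit_continuous_geometric
    (fun n x => (picard n).1 (clamp L x)) Y (2 * K)) => // n x.
  apply: continuous_comp; first exact: continuous_clamp.
  exact: (continuous_picard n).1.
have cU : continuous U.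
  apply: (@uniform_limit_continuous_geometric
    (fun n x => (picard n).2 (clamp L x)) U (2 * K)) => // n x.
  apply: continuous_comp; first exact: continuous_clamp.
  exact: (continuous_picard n).2.
(* The limits [Y] and [U] are constant outside [[0, L]] and may lack the two-sided derivatives at
   the endpoints that [ode] demands. One more integration provides them, and the result agrees with
   the limits on [[0, L]]. *)
pose y := prim (odey s Y U); pose u x := 1 + prim (odeu s l Y U) x.
have cy := continuous_odey cY cU; have cu := continuous_odeu cY cU.
have [S S0 sS] := continuous_bounded cs.
have C0 : 0 <= C S by rewrite !addr_ge0 ?sqr_ge0.
have close n z : 0 <= z <= L ->
    `|(picard n).1 z - Y z| <= 2 * K * 2^-1 ^+ n /\
    `|(picard n).2 z - U z| <= 2 * K * 2^-1 ^+ n.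
  by move=> zL; have := YE z n; have := UE z n; rewrite clampE.
have close' n z : 0 <= z <= L ->
    `|(picard n.+1).1 z - y z| <= C S * (2 * K * 2^-1 ^+ n) * z /\
    `|(picard n.+1).2 z - u z| <= C S * (2 * K * 2^-1 ^+ n) * z.
  move=> /andP[z0 zL]; have [cyn cun] := continuous_picard n.
  have field t : 0 <= t <= z ->
      `|odey s (picard n).1 (picard n).2 t - odey s Y U t| <= C S * (2 * K * 2^-1 ^+ n) /\
      `|odeu s l (picard n).1 (picard n).2 t - odeu s l Y U t| <= C S * (2 * K * 2^-1 ^+ n).
    move=> /andP[t0 tz]; have tL : 0 <= t <= L by rewrite t0 (le_trans tz).
    by have [? ?] := close n t tL; apply: ode_field_dist => //; exact: sS.
  split.
    apply: dist_prim => //; [exact: continuous_odey|].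
    by move=> t /field[].
  rewrite /= /u opprD addrACA subrr add0r.
  apply: dist_prim => //; [exact: continuous_odeu|].
  by move=> t /field[].
have lim_eq (v : nat -> R) (a b M N : R) :
    (forall n, `|v n - a| <= M * 2^-1 ^+ n) ->
    (forall n, `|v n.+1 - b| <= N * 2^-1 ^+ n) -> a = b.
  move=> va vb; apply/eqP; rewrite -subr_eq0 -normr_le0.
  apply/ler_addgt0Pr => e e0; rewrite add0r.
  have [n ne] := geometric_small (M / 2 + N) e0.
  have := va n.+1; have := vb n; rewrite exprS => vbn van.
  have -> : a - b = (v n.+1 - b) - (v n.+1 - a) by ring.
  by rewrite (le_trans (ler_normB _ _))//; lra.
have yY z : 0 <= z <= L -> Y z = y z.
  move=> zL; apply: (@lim_eq (fun n => (picard n).1 z) _ _ (2 * K) (C S * (2 * K) * z)).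
    by move=> n; exact: (close n z zL).1.
  by move=> n; rewrite mulrAC -[_ * _ * _ ^+ _]mulrA; exact: (close' n z zL).1.
have uU z : 0 <= z <= L -> U z = u z.
  move=> zL; apply: (@lim_eq (fun n => (picard n).2 z) _ _ (2 * K) (C S * (2 * K) * z)).
    by move=> n; exact: (close n z zL).2.
  by move=> n; rewrite mulrAC -[_ * _ * _ ^+ _]mulrA; exact: (close' n z zL).2.
exists y, u; split.
- exact: continuous_prim.
- by move=> x; apply: cvgD; [exact: cvg_cst|exact: continuous_prim].
- by rewrite /y prim0.
- by rewrite /u prim0// addr0.
- move=> x xL; split.
    have -> : odey s y u x = odey s Y U x by rewrite /odey -yY// -uU.
    exact: is_derive_prim.
  have -> : odeu s l y u x = odeu s l Y U x by rewrite /odeu -yY// -uU.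
  by rewrite /u -[odeu _ _ _ _ _]add0r; have := is_derive_prim cu x => ?; exact: is_deriveD.
Qed.

End existence.

(** * Dirichlet eigenvalues and the shooting problem *)

Section dirichlet_shooting.
Context {R : realType}.
Local Notation mu := (@lebesgue_measure R).
Variable L : R.
Hypothesis L0 : 0 < L.
Implicit Types (f g s : R -> R).

Lemma ae_imp (P Q : R -> Prop) : (forall x, P x -> Q x) ->
  {ae mu, forall x, P x} -> {ae mu, forall x, Q x}.
Proof. by move=> PQ; apply: filterS => //; exact: (ae_filter_ringOfSetsType mu). Qed.

Lemma abs_continuous_clamp f : abs_continuous 0 L f ->
  continuous (fun x => f (clamp L x)).
Proof.
move=> fac x; apply/cvgrPdist_le => e e0.
have [del del0 fe] := fac e e0.
have cle p q : 0 <= p -> p <= q -> q <= L -> q - p < del -> `|f q - f p| < e.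
  move=> p0 pq qL qpdel; have := fe 1%N (cst p) (cst q).
  rewrite !big_ord1; apply => //.
  by apply/trivIsetP => i j _ _; rewrite !ord1 eqxx.
exists del => //= z xz; have := le_lt_trans (clamp_dist L0 x z) xz.
have /andP[? ?] := clamp_itv L0 x; have /andP[? ?] := clamp_itv L0 z.
have := ler_norm (clamp L x - clamp L z).
have := ler_norm (clamp L z - clamp L x); rewrite distrC => ? ? ?.
have [xz'|xz'] := leP (clamp L x) (clamp L z).
  by rewrite distrC; apply: ltW; apply: cle => //; lra.
by apply: ltW; apply: cle => //; lra.
Qed.

Lemma abs_continuousB_lipschitz a b f g M : abs_continuous a b f ->
  (forall p q, a <= p -> p <= q -> q <= b -> `|g q - g p| <= M * (q - p)) ->
  abs_continuous a b (fun x => f x - g x).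
Proof.
move=> fac gM e e0; have e2 : 0 < e / 2 by lra.
have [del del0 fe] := fac (e / 2) e2.
pose M' := `|M| + 1; have M'0 : 0 < M' by rewrite ltr_wpDl.
exists (Num.min del (e / 2 / M')); first by rewrite lt_min del0 divr_gt0.
move=> n p q pq tpq; rewrite lt_min => /andP[pqdel].
rewrite ltr_pdivlMr// mulrC => pqM.
rewrite (@le_lt_trans _ _ (\sum_(i < n) `|f (q i) - f (p i)| +
                           \sum_(i < n) M' * (q i - p i)))//.
  rewrite -big_split/=; apply: ler_sum => i _; have [ap pqi qb] := pq i.
  have -> : f (q i) - g (q i) - (f (p i) - g (p i)) =
    (f (q i) - f (p i)) - (g (q i) - g (p i)) by ring.
  rewrite (le_trans (ler_normB _ _))// lerD2l (le_trans (gM _ _ _ _ _))//.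
  rewrite ler_wpM2r ?subr_ge0// /M' (le_trans (ler_norm _))//.
  by rewrite lerDl.
by rewrite -mulr_sumr; have := fe n p q pq tpq pqdel; lra.
Qed.

(** Subtracting the primitive leaves an absolutely continuous function with zero derivative almost
    everywhere. This upgrades the almost-everywhere equations of [dirichlet_op] to classical
    ones. *)
Lemma ae_derive_primitive f g : abs_continuous 0 L f -> continuous g ->
  {ae mu, forall x, x \in `]0, L[ -> is_derive x 1 f (g x)} ->
  forall x, 0 <= x <= L -> f x = f 0 + prim g x.
Proof.
move=> fac cg fg x /andP[x0 xL].
have [M M0 gM] := continuous_bounded L0 cg.
pose h z := f z - prim g z.
have hac : abs_continuous 0 x h.
  apply: (abs_continuousW xL); apply: (@abs_continuousB_lipschitz _ _ _ _ M) => //.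
  move=> p q p0 pq qL; apply: (@dist_derive_le R (prim g) g) => //.
    by move=> z _; exact: is_derive_prim.
  by move=> z /andP[pz zq]; rewrite gM// (le_trans p0)//= (le_trans zq).
suff : h x = h 0 by rewrite /h prim0// subr0 => <-; rewrite subrK.
apply: abs_continuous_ae_derive0 => //.
apply: (ae_imp _ fg) => z fz; rewrite in_itv/= => /andP[z0 zx].
have ? : is_derive z 1 f (g z).
  by apply: fz; rewrite in_itv/= z0 (lt_le_trans zx).
have ? := is_derive_prim cg z.
by rewrite -(subrr (g z)); exact: is_deriveB.
Qed.

End dirichlet_shooting.

Section dirichlet_eigenvalue.
Context {R : realType}.
Local Notation mu := (@lebesgue_measure R).
Local Notation pi := (@pi R).

(** An eigenfunction and its quasi-derivative solve the same linear system as the shooting solution,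
    so by uniqueness they are [w 0] times it; [w 0] is nonzero since the eigenfunction is not
    null. *)
Lemma dirichlet_eigenvalue_shooting (s y u : R -> R) (l : R) : continuous s ->
  dirichlet_eigenvalue s l -> shooting pi s l y u -> y pi = 0.
Proof.
move=> cs [v vN0 [_ _ vac [v0 vpi] [w [wac vw] wl]]] [_ _ y0 u0 yu].
have pi0 := pi_gt0 R.
pose V x := v (clamp pi x); pose W x := w (clamp pi x).
have cV : continuous V by exact: abs_continuous_clamp.
have cW : continuous W by exact: abs_continuous_clamp.
have VE x : 0 <= x <= pi -> V x = v x by move=> xpi; rewrite /V clampE.
have WE x : 0 <= x <= pi -> W x = w x by move=> xpi; rewrite /W clampE.
have co x : x \in `]0, pi[ -> 0 <= x <= pi.
  by rewrite in_itv/= => /andP[? ?]; rewrite !ltW.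
have cy := continuous_odey cs cV cW; have cu := continuous_odeu (l := l) cs cV cW.
have vY x : 0 <= x <= pi -> v x = prim (odey s V W) x.
  move=> xpi; rewrite (ae_derive_primitive pi0 vac cy _ xpi) ?v0 ?add0r//.
  apply: (ae_imp _ vw) => z vz zpi; have [dv we] := vz zpi.
  rewrite /odey VE ?WE ?co// we subrK derive1E; exact: derivableP.
have wU x : 0 <= x <= pi -> w x = w 0 + prim (odeu s l V W) x.
  move=> xpi; rewrite (ae_derive_primitive pi0 wac cu _ xpi)//.
  apply: (ae_imp _ wl) => z wz zpi; have [dw we] := wz zpi.
  have -> : odeu s l V W z = derive1 w z.
    by move: we; rewrite /odeu VE ?WE ?co// => we; lra.
  rewrite derive1E; exact: derivableP.
pose p x := prim (odey s V W) x - w 0 * y x.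
pose q x := w 0 + prim (odeu s l V W) x - w 0 * u x.
have [S S0 sS] := continuous_bounded pi0 cs.
have pq0 : forall x, 0 <= x <= pi -> p x = 0.
  apply: (@ode_eq0 _ _ (S + `|l|) s l p q).
  - by move=> x /sS /le_trans; apply; rewrite lerDl.
  - by rewrite lerDr.
  - move=> x xpi; have [? ?] := yu x xpi.
    have ? := is_derive_prim cy x; have ? := is_derive_prim cu x.
    split.
      rewrite /p; apply: is_derive_eq.
      rewrite /GRing.scale/= /odey /p /q -vY// -wU// VE// WE//; ring.
    rewrite /q; apply: is_derive_eq.
    rewrite /GRing.scale/= /odeu /p /q -vY// -wU// VE// WE//; ring.
  - by rewrite /p prim0// y0 mulr0 subr0.
  - by rewrite /q prim0// u0; ring.
have vy x : 0 <= x <= pi -> v x = w 0 * y x.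
  by move=> xpi; apply/eqP; rewrite -subr_eq0 vY// -/(p x) pq0.
have w0 : w 0 != 0.
  apply/negP => /eqP w0; apply: vN0; apply: aeW => x /= /co xpi.
  by rewrite vy// w0 mul0r.
have := vy pi; rewrite vpi lexx ltW// => /(_ isT) /esym/eqP.
by rewrite mulf_eq0 (negPf w0) => /eqP.
Qed.

End dirichlet_eigenvalue.

(** * Squares of eigenfunctions and the Wronskian *)

Section resonance.
Context {R : realType}.
Variable L : R.
Hypothesis L0 : 0 < L.
Implicit Types (s y u : R -> R) (l x b t : R).

Lemma is_derive1_unique (f : R -> R) x (a b : R) :
  is_derive x 1 f a -> is_derive x 1 f b -> a = b.
Proof. by move=> [_ <-] [_ <-]. Qed.

Lemma is_derive1_eq_oo (f g : R -> R) x (a b : R) : 0 < x < L ->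
  (forall z, 0 < z < L -> f z = g z) ->
  is_derive x 1 f a -> is_derive x 1 g b -> a = b.
Proof.
move=> /andP[x0 xL] fg fa gb.
suff : is_derive x 1 g a by move=> /is_derive1_unique; apply.
apply: near_eq_is_derive fa.
have : \forall z \near x, z \in `]0, L[ by apply: near_in_itvoo; rewrite in_itv/= x0.
by apply: filterS => z; rewrite in_itv/= => /fg.
Qed.

(** If [y] vanished throughout the open interval, its derivative [u + s y] would too, hence [u] as
    well, against [u 0 = 1] and continuity. *)
Lemma shooting_neq0 s l y u : shooting L s l y u ->
  exists2 x, 0 < x < L & y x != 0.
Proof.
move=> [cy cu y0 u0 yu]; apply: contrapT => yN.
have y_eq0 x : 0 < x < L -> y x = 0.
  by move=> xL; apply/eqP; apply: contrapT => /negP ?; apply: yN; exists x.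
have u_eq0 x : 0 < x < L -> u x = 0.
  move=> xL; have [|dy _] := yu x; first by case/andP: xL => *; rewrite !ltW.
  have := is_derive1_eq_oo (g := cst 0) xL y_eq0 dy (is_derive_cst _ _ _).
  by rewrite /odey y_eq0// mulr0 addr0.
have : u x @[x --> (0 : R)] --> (1 : R) by rewrite -u0; exact: cu.
move=> /cvgrPdist_lt /(_ 1 ltr01)[r /= r0 ur].
pose x := Num.min (r / 2) (L / 2).
have x0 : 0 < x by rewrite lt_min !divr_gt0.
have xr : x <= r / 2 by rewrite ge_min lexx.
have xL : x <= L / 2 by rewrite ge_min lexx orbT.
have : `|1 - u x| < 1.
  by apply: ur => /=; rewrite sub0r normrN gtr0_norm//; lra.
by rewrite u_eq0 ?subr0 ?normr1 ?ltxx// x0; lra.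
Qed.

(* Differentiating [\sum_i c i * y i ^+ 2 = 0] three times along the linear
   system satisfied by [(y ^+ 2, y * u, u ^+ 2)] yields the same relation with
   the coefficients [c i * l i]. *)
Lemma squares_relation_mulr n (c l : 'I_n -> R) s (y u : 'I_n -> R -> R) :
  (forall i, shooting L s (l i) (y i) (u i)) ->
  (forall x, 0 < x < L -> \sum_i c i * y i x ^+ 2 = 0) ->
  forall x, 0 < x < L -> \sum_i c i * l i * y i x ^+ 2 = 0.
Proof.
move=> yu Y0.
have oc x : 0 < x < L -> 0 <= x <= L by move=> /andP[? ?]; rewrite !ltW.
pose Y (d : 'I_n -> R) x := \sum_i d i * y i x ^+ 2.
pose V (d : 'I_n -> R) x := \sum_i d i * (y i x * u i x).
pose W (d : 'I_n -> R) x := \sum_i d i * u i x ^+ 2.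
pose cl i := c i * l i.
have YE d x : 0 <= x <= L -> is_derive x 1 (Y d) (2 * V d x + 2 * s x * Y d x).
  move=> xL.
  have E : \sum_i d i * (2 * y i x * odey s (y i) (u i) x) =
      2 * V d x + 2 * s x * Y d x.
    rewrite /V /Y !mulr_sumr -big_split/=; apply: eq_bigr => i _.
    by rewrite /odey; ring.
  refine (is_derive_eq _ E).
  have -> : Y d = \sum_i (fun x => d i * y i x ^+ 2).
    by apply/funext => z; rewrite /Y fct_sumE.
  apply: is_derive_sum => i; have [_ _ _ _ /(_ x xL)[? _]] := yu i.
  by apply: is_derive_eq; rewrite /GRing.scale/=; ring.
have VE d x : 0 <= x <= L -> is_derive x 1 (V d)
    (W d x - s x ^+ 2 * Y d x - Y (fun i => d i * l i) x).
  move=> xL.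
  have E : \sum_i d i * (y i x * odeu s (l i) (y i) (u i) x +
                    u i x * odey s (y i) (u i) x) =
      W d x - s x ^+ 2 * Y d x - Y (fun i => d i * l i) x.
    rewrite /W /Y mulr_sumr -!sumrB; apply: eq_bigr => i _.
    by rewrite /odey /odeu; ring.
  refine (is_derive_eq _ E).
  have -> : V d = \sum_i (fun x => d i * (y i x * u i x)).
    by apply/funext => z; rewrite /V fct_sumE.
  apply: is_derive_sum => i; have [_ _ _ _ /(_ x xL)[? ?]] := yu i.
  by apply: is_derive_eq; rewrite /GRing.scale/=; ring.
have WE d x : 0 <= x <= L -> is_derive x 1 (W d)
    (- 2 * s x * W d x - 2 * s x ^+ 2 * V d x - 2 * V (fun i => d i * l i) x).
  move=> xL.
  have E : \sum_i d i * (2 * u i x * odeu s (l i) (y i) (u i) x) =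
      - 2 * s x * W d x - 2 * s x ^+ 2 * V d x - 2 * V (fun i => d i * l i) x.
    rewrite /W /V !mulr_sumr -!sumrB; apply: eq_bigr => i _.
    by rewrite /odeu; ring.
  refine (is_derive_eq _ E).
  have -> : W d = \sum_i (fun x => d i * u i x ^+ 2).
    by apply/funext => z; rewrite /W fct_sumE.
  apply: is_derive_sum => i; have [_ _ _ _ /(_ x xL)[_ ?]] := yu i.
  by apply: is_derive_eq; rewrite /GRing.scale/=; ring.
have V0 x : 0 < x < L -> V c x = 0.
  move=> xL; have := is_derive1_eq_oo (g := cst 0) xL Y0 (YE c x (oc x xL))
    (is_derive_cst _ _ _).
  by rewrite [Y c x]Y0// mulr0 addr0 => /eqP; rewrite mulf_eq0 pnatr_eq0 => /eqP.
have WY x : 0 < x < L -> W c x = Y cl x.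
  move=> xL; have := is_derive1_eq_oo (g := cst 0) xL V0 (VE c x (oc x xL))
    (is_derive_cst _ _ _).
  by rewrite [Y c x]Y0// mulr0 subr0 => /eqP; rewrite subr_eq0 => /eqP.
(* Differentiating both sides of [WY] gives, up to a factor 2, that the derivative of [Y cl]
   vanishes; at 0 this follows from the initial values. So [Y cl] is constant, with value 0 at 0. *)
have dY0 x : 0 <= x < L -> 2 * V cl x + 2 * s x * Y cl x = 0.
  move=> /andP[]; rewrite le_eqVlt => /predU1P[<- _|x0 xL].
    have [V00 Y00] : V cl 0 = 0 /\ Y cl 0 = 0.
      by split; apply: big1 => i _; have [_ _ -> _ _] := yu i;
        rewrite ?expr0n ?mul0r ?mulr0.
    by rewrite V00 Y00 !mulr0 addr0.
  have xoo : 0 < x < L by rewrite x0.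
  have := is_derive1_eq_oo xoo WY (WE c x (oc x xoo)) (YE cl x (oc x xoo)).
  rewrite [V c x]V0// -[V (fun _ => _) x]/(V cl x) WY//; lra.
move=> x /andP[x0 xL]; rewrite -/(Y cl x).
have -> : Y cl x = Y cl 0.
  apply: constant_derive0; first exact: ltW.
  move=> z /andP[z0 zx]; rewrite -(dY0 z) ?z0 ?(le_lt_trans zx)//.
  by apply: YE; rewrite z0 (le_trans zx)// ltW.
by apply: big1 => i _; have [_ _ -> _ _] := yu i; rewrite expr0n mulr0.
Qed.

(** Multiplying the coefficients successively by [l k - l j] for all [j != i], as in Lagrange
    interpolation, kills every term but the [i]-th, whose factor is nonzero because [l] is
    injective. *)
Lemma squares_free n (c l : 'I_n -> R) s (y u : 'I_n -> R -> R) : injective l ->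
  (forall i, shooting L s (l i) (y i) (u i)) ->
  (forall x, 0 < x < L -> \sum_i c i * y i x ^+ 2 = 0) -> forall i, c i = 0.
Proof.
move=> linj yu Y0 i.
have prodY (r : seq 'I_n) x : 0 < x < L ->
    \sum_k c k * (\prod_(j <- r) (l k - l j)) * y k x ^+ 2 = 0.
  elim: r x => [x xL|j r IH x xL].
    by rewrite -[RHS](Y0 x xL); apply: eq_bigr => k _; rewrite big_nil mulr1.
  have H := squares_relation_mulr yu IH xL.
  pose p k := c k * \prod_(j <- r) (l k - l j).
  transitivity ((\sum_k p k * l k * y k x ^+ 2) - l j * \sum_k p k * y k x ^+ 2).
    rewrite mulr_sumr -sumrB; apply: eq_bigr => k _.
    by rewrite big_cons /p; ring.
  by rewrite H IH// mulr0 subr0.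
have [x xL yx] := shooting_neq0 (yu i).
have := prodY [seq j <- index_enum _ | j != i] x xL.
under eq_bigr do rewrite big_filter.
rewrite (bigD1 i)//= [X in _ + X]big1 ?addr0; last first.
  by move=> k ki; rewrite (bigD1 k)//= subrr mul0r mulr0 mul0r.
move/eqP; rewrite !mulf_eq0 orbb (negPf yx) orbF => /orP[/eqP//|].
rewrite prodf_seq_eq0 => /hasP[j _ /andP[ji]].
by rewrite subr_eq0 => /eqP/linj ij; rewrite ij eqxx in ji.
Qed.

Lemma wronskian_shift s s' l l' y u y' u' b t : 0 < b < L ->
  (forall x, 0 <= x <= L -> s' x = s x + t * Num.min x b) ->
  shooting L s l y u -> shooting L s' l' y' u' -> y L = 0 -> y' L = 0 ->
  (l' - l) * prim (fun x => y x * y' x) L = t * prim (fun x => y x * y' x) b.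
Proof.
move=> /andP[b0 bL] s's [cy _ y0 u0 yu] [cy' _ y'0 u'0 yu'] yL y'L.
pose g x := y x * y' x.
have cg : continuous g by move=> x; apply: cvgM; [exact: cy|exact: cy'].
rewrite -/g.
(* With [g] the product of the two solutions, the quasi-Wronskian has derivative (s' - s) g' + (l' -
   l) g, where g' is the derivative of [g]. Integration by parts, with s' - s equal to t x on
   [[0, b]] and to t b on [[b, L]], makes [G1] and [G2] constant on their intervals; the splitting
   avoids differentiating at the kink. *)
pose G1 x := u x * y' x - y x * u' x - t * x * g x - ((l' - l) - t) * prim g x.
pose G2 x := u x * y' x - y x * u' x - t * b * g x - (l' - l) * prim g x.
have G1b : G1 b = G1 0.
  apply: constant_derive0; first exact: ltW.
  move=> x /andP[x0 xb]; have xL : 0 <= x <= L by rewrite x0 (le_trans xb)// ltW.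
  have [? ?] := yu x xL; have [? ?] := yu' x xL; have ? := is_derive_prim cg x.
  rewrite /G1 /g; apply: is_derive_eq.
  rewrite /GRing.scale/= /odey /odeu s's// (min_idPl xb) /g; ring.
have G2b : G2 L = G2 b.
  apply: constant_derive0; first exact: ltW.
  move=> x /andP[bx xL']; have xL : 0 <= x <= L by rewrite xL' (le_trans _ bx)// ltW.
  have [? ?] := yu x xL; have [? ?] := yu' x xL; have ? := is_derive_prim cg x.
  rewrite /G2 /g; apply: is_derive_eq.
  rewrite /GRing.scale/= /odey /odeu s's// (min_idPr bx) /g; ring.
move: G1b G2b; rewrite /G1 /G2 /g y0 y'0 yL y'L prim0// !(mulr0, mul0r).
lra.
Qed.

End resonance.

(** * Isolation of resonances near a given resonant path *)

Section resonance_neighbourhood.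
Context {R : realType}.
Variable L : R.
Hypothesis L0 : 0 < L.
Implicit Types (s : R -> R) (l x b t : R).

Definition shoot s l : R -> R :=
  xget (cst 0) [set y : R -> R | exists u, shooting L s l y u].

Lemma shootP s l : continuous s -> exists u, shooting L s l (shoot s l) u.
Proof.
move=> cs; rewrite /shoot; set A := [set _ | _].
exact: (@xgetPex _ (cst 0) A (shooting_exists L0 l cs)).
Qed.

Lemma prim_sqr_gt0 s l y u : shooting L s l y u ->
  0 < prim (fun x => y x * y x) L.
Proof.
move=> yu; have [cy _ _ _ _] := yu.
have cyy : continuous (fun x => y x * y x) by move=> x; apply: cvgM; exact: cy.
have Qnd a b : 0 <= a -> a <= b ->
    prim (fun x => y x * y x) a <= prim (fun x => y x * y x) b.
  move=> a0 ab; apply: (nondecreasing_derive ab (df := fun x => y x * y x)).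
    by move=> x _; exact: is_derive_prim.
  by move=> x _; rewrite -expr2 sqr_ge0.
have Q0 := prim0 cyy.
rewrite lt_neqAle; apply/andP; split; last by rewrite -Q0 Qnd// ltW.
apply/eqP => QL; have [x xL yx] := shooting_neq0 L0 yu.
have Qx z : 0 < z < L -> prim (fun x => y x * y x) z = cst 0 z.
  move=> /andP[z0 zL]; apply/le_anti/andP; split.
    by rewrite [leRHS]QL Qnd// ltW.
  by rewrite -[leLHS]Q0 Qnd// ltW.
have := is_derive1_eq_oo xL Qx (is_derive_prim cyy x) (is_derive_cst _ _ _).
by move/eqP; rewrite mulf_eq0 orbb (negPf yx).
Qed.

Lemma cvg_sumr (I T : Type) (F : set_system T) {FF : Filter F} (r : seq I)
    (f : I -> T -> R) (a : I -> R) :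
  (forall i, f i k @[k --> F] --> a i) ->
  \sum_(i <- r) f i k @[k --> F] --> \sum_(i <- r) a i.
Proof.
move=> fa; elim: r => [|i r IH].
  by under eq_cvg do rewrite big_nil; rewrite big_nil; exact: cvg_cst.
by under eq_cvg do rewrite big_cons; rewrite big_cons; exact: cvgD.
Qed.

(** Continuity of a sum of quotients where the denominators are nonzero, by contradiction along
    perturbations of size 1 / (k + 1). *)
Lemma ratio_sum_stable n (c q0 r0 : 'I_n -> R) : (forall i, r0 i != 0) ->
  \sum_i c i * (q0 i / r0 i) != 0 ->
  exists2 e, 0 < e & forall q r : 'I_n -> R,
    (forall i, `|q i - q0 i| <= e /\ `|r i - r0 i| <= e) ->
    (forall i, r i != 0) /\ \sum_i c i * (q i / r i) != 0.
Proof.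
move=> r00 sum0; apply: contrapT => noe.
have /choice[qr qrP] : forall k : nat, exists qr : ('I_n -> R) * ('I_n -> R),
    (forall i, `|qr.1 i - q0 i| <= k.+1%:R^-1 /\ `|qr.2 i - r0 i| <= k.+1%:R^-1) /\
    ~ ((forall i, qr.2 i != 0) /\ \sum_i c i * (qr.1 i / qr.2 i) != 0).
  move=> k; apply: contrapT => noqr; apply: noe; exists k.+1%:R^-1 => //.
  move=> q r qre; apply: contrapT => nqr; apply: noqr; exists (q, r); split=> //.
have cvg_close (v : nat -> R) (a : R) : (forall k, `|v k - a| <= k.+1%:R^-1) ->
    v k @[k --> \oo] --> a.
  move=> va; apply/cvgrPdist_le => e e0.
  have /cvgrPdist_le /(_ e e0) := @cvg_harmonic R.
  apply: filterS => k; rewrite sub0r normrN ger0_norm ?invr_ge0// => ke.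
  by rewrite distrC (le_trans (va k)).
have cq i : (qr k).1 i @[k --> \oo] --> q0 i.
  by apply: cvg_close => k; have [/(_ i)[]] := qrP k.
have cr i : (qr k).2 i @[k --> \oo] --> r0 i.
  by apply: cvg_close => k; have [/(_ i)[]] := qrP k.
have csum : \sum_i c i * ((qr k).1 i / (qr k).2 i) @[k --> \oo] -->
    \sum_i c i * (q0 i / r0 i).
  apply: cvg_sumr => i; apply: cvgM; first exact: cvg_cst.
  by apply: cvgM => //; apply: cvgV => //; exact: r00.
have near_r : \forall k \near \oo, forall i, (qr k).2 i != 0.
  apply: filter_forall => i; exact: (cvgr_neq0 _ (cr i) (r00 i)).
have near_s : \forall k \near \oo, \sum_i c i * ((qr k).1 i / (qr k).2 i) != 0.
  exact: (cvgr_neq0 _ csum sum0).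
have [k [rk sk]] : exists k, (forall i, (qr k).2 i != 0) /\
    \sum_i c i * ((qr k).1 i / (qr k).2 i) != 0.
  apply: (@filter_ex _ (nbhs (\oo : set_system nat))).
  by apply: filterS2 near_r near_s.
by have [_] := qrP k; apply.
Qed.

(** The derivative of [F] combines the squares of the solutions at the centre with coefficients
    [c i / Q0 i L], not all zero; so [F] is nonzero somewhere, and by continuity at a rational [b].
    At the centre both factors of each Wronskian integral coincide; stability of the quotients then
    covers all close pairs with one [e]. *)
Lemma resonance_isolated n (c l0 : 'I_n -> R) s0 : continuous s0 ->
  injective l0 -> (exists i, c i != 0) ->
  exists b : rat, 0 < (ratr b : R) < L /\
  exists2 e, 0 < e & forall s s' (l l' : 'I_n -> R) t,
    continuous s -> continuous s' ->
    (forall x, 0 <= x <= L -> `|s x - s0 x| <= e) ->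
    (forall x, 0 <= x <= L -> `|s' x - s0 x| <= e) ->
    (forall i, `|l i - l0 i| <= e /\ `|l' i - l0 i| <= e) ->
    (forall i, shoot s (l i) L = 0) -> (forall i, shoot s' (l' i) L = 0) ->
    (forall x, 0 <= x <= L -> s' x = s x + t * Num.min x (ratr b)) ->
    \sum_i c i * l i = 0 -> \sum_i c i * l' i = 0 -> t = 0.
Proof.
move=> cs0 l0inj [i0 ci0].
pose y0 i := shoot s0 (l0 i).
have /choice[u0 yu0] i := shootP (l0 i) cs0.
have cy0 i : continuous (y0 i) by have [] := yu0 i.
have cyy i : continuous (fun x => y0 i x * y0 i x).
  by move=> x; apply: cvgM; exact: cy0.
pose Q0 i := prim (fun x => y0 i x * y0 i x).
have Q0L i : 0 < Q0 i L := prim_sqr_gt0 (yu0 i).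
have Q0Ln i : Q0 i L != 0 by rewrite gt_eqF.
pose F x := \sum_i c i * (Q0 i x / Q0 i L).
have F' x : is_derive x 1 F (\sum_i c i / Q0 i L * y0 i x ^+ 2).
  have -> : F = \sum_i (fun x => c i * (Q0 i x / Q0 i L)).
    by apply/funext => z; rewrite /F fct_sumE.
  apply: is_derive_sum => i; have ? := is_derive_prim (cyy i) x.
  by apply: is_derive_eq; rewrite /GRing.scale/= expr2; ring.
have [b [bL Fb]] : exists b : rat, 0 < (ratr b : R) < L /\ F (ratr b) != 0.
  apply: contrapT => nob.
  have F0 x : 0 < x < L -> F x = cst 0 x.
    move=> /andP[x0 xL]; apply: contrapT => /eqP Fx.
    have := cvgr_neq0 _ (is_derive1_continuous (F' x)) Fx.
    rewrite near_simpl => -[r /= r0 rF].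
    pose m := Num.min r (L - x).
    have m0 : 0 < m by rewrite lt_min r0 subr_gt0.
    have [mr mL] : m <= r /\ m <= L - x by rewrite !ge_min !lexx orbT.
    have /rat_in_itvoo[b] : x < x + m by rewrite ltrDl.
    rewrite in_itv/= => /andP[xb bxm]; apply: nob; exists b; split.
      by rewrite (lt_trans x0 xb)/=; lra.
    by apply: rF => /=; rewrite ltr0_norm ?subr_lt0//; lra.
  have cQ : forall i, c i / Q0 i L = 0.
    apply: (squares_free L0 l0inj yu0) => x xL.
    exact: is_derive1_eq_oo xL F0 (F' x) (is_derive_cst _ _ _).
  have := cQ i0; move/eqP; rewrite mulf_eq0 (negPf ci0) invr_eq0/=.
  exact/negP.
exists b; split=> //.
have [e1 e10 ratio] := ratio_sum_stable Q0Ln Fb.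
have [S0 S00 s0S] := continuous_bounded L0 cs0.
pose S := S0 + \sum_i `|l0 i| + 1.
have lS i : `|l0 i| <= \sum_i `|l0 i|.
  by rewrite (bigD1 i)//= lerDl sumr_ge0.
have sum_ge0 : 0 <= \sum_i `|l0 i| by exact: sumr_ge0.
have [M M1 shM] := shooting_bound L S.
have [A A0 shA] := shooting_lipschitz L0 S.
have D0 : 0 < 2 * A * M * L + 1.
  by rewrite ltr_wpDl// !mulr_ge0// ?ltW// (lt_le_trans _ M1).
(* Each of the two factors moves by at most [A * e] while the other stays below [M]; over the length
   [L] the integrals move by at most 2 A M L e, which is at most [e1]. *)
pose e := Num.min 1 (e1 / (2 * A * M * L + 1)).
have e0 : 0 < e by rewrite lt_min ltr01 divr_gt0.
have [e1' ee1] : e <= 1 /\ e <= e1 / (2 * A * M * L + 1).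
  by rewrite !ge_min !lexx orbT.
exists e => // s s' l l' t cs cs' ss0 s's0 ll0 yL y'L s's suml suml'.
have sS (f : R -> R) x : `|f x - s0 x| <= e -> 0 <= x <= L -> `|f x| <= S.
  move=> fe xL; have -> : f x = s0 x + (f x - s0 x) by ring.
  rewrite (le_trans (ler_normD _ _))// /S; have := s0S x xL; lra.
have lS' (a : R) i : `|a - l0 i| <= e -> `|a| <= S.
  move=> ae; have -> : a = l0 i + (a - l0 i) by ring.
  rewrite (le_trans (ler_normD _ _))// /S; have := lS i; lra.
have s0S' x : 0 <= x <= L -> `|s0 x| <= S.
  by move=> xL; apply: sS => //; rewrite subrr normr0 ltW.
have l0S i : `|l0 i| <= S.
  by apply: (lS' _ i); rewrite subrr normr0 ltW.
pose y i := shoot s (l i); pose y' i := shoot s' (l' i).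
have /choice[u yu] i := shootP (l i) cs.
have /choice[u' yu'] i := shootP (l' i) cs'.
have cg i : continuous (fun x => y i x * y' i x).
  by move=> x; have [+ _ _ _ _] := yu i; have [+ _ _ _ _] := yu' i => a1 a2;
    apply: cvgM; [exact: a2|exact: a1].
pose Q i := prim (fun x => y i x * y' i x).
have QQ0 i x : 0 <= x <= L -> `|Q i x - Q0 i x| <= e1.
  move=> /andP[x0 xL]; have [l1 l1'] := ll0 i.
  have M0 : 0 <= M by rewrite (le_trans _ M1).
  rewrite (@le_trans _ _ (2 * A * e * M * x))//.
    apply: dist_prim => // z /andP[z0 zx].
    have zL : 0 <= z <= L by rewrite z0 (le_trans zx).
    have [dy _] := shA _ _ _ _ _ _ _ _ e (fun x xL => sS s x (ss0 x xL) xL)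
      (lS' _ _ l1) s0S' (l0S i) ss0 l1 (yu i) (yu0 i) z zL.
    have [dy' _] := shA _ _ _ _ _ _ _ _ e (fun x xL => sS s' x (s's0 x xL) xL)
      (lS' _ _ l1') s0S' (l0S i) s's0 l1' (yu' i) (yu0 i) z zL.
    have [yM _] := shM _ _ _ _ s0S' (l0S i) (yu0 i) z zL.
    have [y'M _] := shM _ _ _ _ (fun x xL => sS s' x (s's0 x xL) xL)
      (lS' _ _ l1') (yu' i) z zL.
    have -> : y i z * y' i z - y0 i z * y0 i z =
      (y i z - y0 i z) * y' i z + (y' i z - y0 i z) * y0 i z by ring.
    rewrite (le_trans (ler_normD _ _))// !normrM.
    have : `|y i z - y0 i z| * `|y' i z| <= A * e * M by rewrite ler_pM.
    have : `|y' i z - y0 i z| * `|y0 i z| <= A * e * M by rewrite ler_pM.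
    by lra.
  have AM0 : 0 <= 2 * A * M by rewrite !mulr_ge0.
  have : 2 * A * M * e * x <= 2 * A * M * e * L.
    by rewrite ler_wpM2l// mulr_ge0// ltW.
  have : e * (2 * A * M * L + 1) <= e1 by rewrite -ler_pdivlMr.
  by lra.
have [|QLn Qsum] := ratio (fun i => Q i (ratr b)) (fun i => Q i L).
  move=> i; split; apply: QQ0; last by rewrite ltW//= lexx.
  by case/andP: bL => *; rewrite !ltW.
apply: contrapT => /eqP t0; move/negP: Qsum; apply.
have wr i : (l' i - l i) * Q i L = t * Q i (ratr b).
  exact: (wronskian_shift bL s's (yu i) (yu' i)).
(* For [t != 0], the sum kept away from 0 would be [t^-1] times the difference of two resonance
   relations. *)
have qE i : Q i (ratr b) / Q i L = t^-1 * (l' i - l i).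
  by apply: (mulfI t0); rewrite mulrA -wr mulfK// mulVKf.
under eq_bigr do rewrite qE mulrCA mulrBr.
by rewrite -mulr_sumr sumrB suml suml' subrr mulr0.
Qed.

End resonance_neighbourhood.

(** * Measurable sets of paths *)

Section path_space.
Context {R : realType}.
Variable L : R.
Hypothesis L0 : 0 < L.
Implicit Types (f g : R -> R) (x : R).

Definition cylinder : set (set (R -> R)) :=
  [set A | exists x E, [/\ 0 <= x <= L, measurable E & A = [set f : R -> R | E (f x)]]].

Notation path_measurable := (@measurable _ (g_sigma_algebraType cylinder)).

(** A triple (a, b, v) asks for values within [r] of [v] on the time interval from a to b. Rational
    data leave countably many tubes, and testing only rational times makes each of them
    measurable. *)
Definition tube (s : seq (rat * rat * rat)) (r : rat) : set (R -> R) :=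
  [set f | forall p, p \in s -> forall q : rat, 0 <= (ratr q : R) <= L ->
     p.1.1 <= q <= p.1.2 -> `|f (ratr q) - ratr p.2| <= ratr r].

Lemma cylinder_measurable x (E : set R) : 0 <= x <= L -> measurable E ->
  path_measurable [set f | E (f x)].
Proof. by move=> xL mE; apply: sub_sigma_algebra; exists x, E. Qed.

Lemma tube_measurable s r : path_measurable (tube s r).
Proof.
pose A (p : rat * rat * rat) (q : rat) : set (R -> R) :=
  if (0 <= (ratr q : R) <= L) && (p.1.1 <= q <= p.1.2) && (p \in s) then
    [set f | `|f (ratr q) - ratr p.2| <= ratr r] else setT.
have mA p q : path_measurable (A p q).
  rewrite /A; case: ifPn => [/andP[/andP[qL _] _]|_]; last exact: measurableT.
  pose E : set R := [set z | `|z - ratr p.2| <= ratr r].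
  apply: (@cylinder_measurable _ E) => //.
  have -> : E = `[ratr p.2 - ratr r, ratr p.2 + ratr r]%classic.
    by apply/seteqP; split=> z /=; rewrite /E/= in_itv/= ler_distl.
  exact: measurable_itv.
suff -> : tube s r = ~` \bigcup_p \bigcup_q ~` A p q.
  apply: measurableC; apply: countable_bigcupT_measurable => // p.
  by apply: countable_bigcupT_measurable => // q; exact: measurableC.
apply/seteqP; split=> f.
  move=> fs [p _ [q _]]; apply; rewrite /A.
  by case: ifPn => // /andP[/andP[qL pq] ps]; exact: fs.
move=> fA p ps q qL pq; apply: contrapT => fq; apply: fA.
by exists p => //; exists q => //; rewrite /A qL pq ps.
Qed.

Lemma rat_near x (P : set R) : 0 <= x <= L -> (\forall z \near x, P z) ->
  exists q : rat, 0 <= (ratr q : R) <= L /\ P (ratr q).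
Proof.
move=> /andP[x0 xL] [r /= r0 rP].
have [xltL|] := ltP x L.
  pose m := Num.min r (L - x).
  have m0 : 0 < m by rewrite lt_min r0 subr_gt0.
  have [mr mL] : m <= r /\ m <= L - x by rewrite !ge_min !lexx orbT.
  have /rat_in_itvoo[q] : x < x + m by rewrite ltrDl.
  rewrite in_itv/= => /andP[xq qm]; exists q; split; first by lra.
  by apply: rP => /=; rewrite ltr0_norm ?subr_lt0//; lra.
move=> Lx; pose m := Num.min r L.
have m0 : 0 < m by rewrite lt_min r0.
have [mr mL] : m <= r /\ m <= L by rewrite !ge_min !lexx orbT.
have /rat_in_itvoo[q] : x - m < x by rewrite ltrBlDr ltrDl.
rewrite in_itv/= => /andP[xq qm]; exists q; split; first by lra.
by apply: rP => /=; rewrite gtr0_norm ?subr_gt0//; lra.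
Qed.

(** Tubes play the role of a countable base for uniform convergence on continuous paths. Compactness
    of [[0, L]] yields finitely many time windows, and [r < e / 2] lets the deviations of [f] and
    [g] add up to less than [e]. *)
Lemma ex_tube f (e : R) : continuous f -> 0 < e -> exists s r,
  tube s r f /\ forall g, continuous g -> tube s r g ->
    forall x, 0 <= x <= L -> `|g x - f x| <= e.
Proof.
move=> cf e0.
have /rat_in_itvoo[r] : 0 < e / 2 by lra.
rewrite in_itv/= => /andP[r0 re].
pose D : set (rat * rat * rat) := [set p | forall z : R,
  ratr p.1.1 <= z <= ratr p.1.2 -> `|f z - ratr p.2| <= ratr r].
pose I (p : rat * rat * rat) : set R := `]ratr p.1.1, ratr p.1.2[%classic.
have := @segment_compact R 0 L.
rewrite compact_cover => /(_ _ D I) [p _||F FD cov].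
- exact: interval_open.
- move=> x _.
  have /rat_in_itvoo[v] : f x < f x + ratr r / 2 by rewrite ltrDl divr_gt0.
  rewrite in_itv/= => /andP[fv vf].
  have : \forall z \near x, `|f x - f z| <= ratr r / 2.
    by have /cvgrPdist_le := cf x; apply; lra.
  move=> [del /= del0 fdel].
  have /rat_in_itvoo[a] : x - del < x by rewrite ltrBlDr ltrDl.
  have /rat_in_itvoo[b] : x < x + del by rewrite ltrDl.
  rewrite !in_itv/= => /andP[xb bdel] /andP[dela ax].
  exists (a, b, v); last by rewrite /I/= in_itv/= ax.
  move=> z /= /andP[az zb].
  have : `|f x - f z| <= ratr r / 2.
    by apply: fdel => /=; rewrite ltr_norml; lra.
  by rewrite !ler_norml; lra.
- exists (enum_fset F), r; split.
    move=> p pF q qL /andP[pq qp].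
    have := FD p pF; rewrite inE; apply; rewrite !ler_rat; exact/andP.
  move=> g cg gF x xL.
  have [p /= pF] := cov x xL; rewrite /I/= in_itv/= => /andP[px xp].
  have fx : `|f x - ratr p.2| <= ratr r.
    by have := FD p pF; rewrite inE; apply; rewrite !ltW.
  have gx : `|g x - ratr p.2| <= ratr r.
    rewrite leNgt; apply/negP => gx.
    have n1 : \forall z \near x, z \in `]ratr p.1.1, ratr p.1.2[.
      by apply: near_in_itvoo; rewrite in_itv/= px.
    have n2 : \forall z \near x, ratr r < `|g z - ratr p.2|.
      have cgn : (fun z => `|g z - ratr p.2|) @ x --> `|g x - ratr p.2|.
        by apply: cvg_norm; apply: cvgB; [exact: cg|exact: cvg_cst].
      exact: (cvgr_gt _ cgn _ gx).
    have [q [qL]] := rat_near xL (filterI n1 n2).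
    rewrite /setI/= in_itv/= => -[/andP[pq qp] gq].
    have /(gF p pF q qL) : p.1.1 <= q <= p.1.2.
      by rewrite -!(ler_rat R) (ltW pq) (ltW qp).
    by rewrite leNgt gq.
  have -> : g x - f x = (g x - ratr p.2) - (f x - ratr p.2) by ring.
  by rewrite (le_trans (ler_normB _ _))//; lra.
Qed.

(** On continuous paths the complement of [N] is a countable union of tubes. The agreement is
    claimed only there, since countably many evaluations cannot detect continuity. *)
Lemma closed_path_measurable (N : set (R -> R)) :
  (forall f, continuous f -> ~ N f -> exists2 e : R, 0 < e &
    forall g, continuous g -> (forall x, 0 <= x <= L -> `|g x - f x| <= e) ->
      ~ N g) ->
  exists A, path_measurable A /\ forall f, continuous f -> A f <-> N f.
Proof.
move=> Nopen.
pose J : set (seq (rat * rat * rat) * rat) :=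
  [set sr | forall g, continuous g -> tube sr.1 sr.2 g -> ~ N g].
exists (~` \bigcup_sr (if sr \in J then tube sr.1 sr.2 else set0)); split.
  apply: measurableC; apply: countable_bigcupT_measurable => // -[s r].
  by case: ifP => _; [exact: tube_measurable|exact: measurable0].
move=> f cf; split.
  move=> fJ; apply: contrapT => Nf; apply: fJ.
  have [e e0 Ne] := Nopen f cf Nf.
  have [s [r [fsr sre]]] := ex_tube cf e0.
  exists (s, r) => //; rewrite mem_set//= => g cg gsr.
  by apply: Ne => //; exact: sre.
move=> Nf [[s r] _]; case: ifPn => // /set_mem J_ fsr.
exact: (J_ f cf fsr).
Qed.

End path_space.

(** * Countable measurable cover of the resonant paths *)

Section resonance_set.
Context {R : realType}.
Variable L : R.
Hypothesis L0 : 0 < L.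
Variables (n : nat) (c : 'I_n -> R).
Implicit Types (f g : R -> R) (k : {ffun 'I_n -> rat * rat}).

(** The tuple is quantified existentially and carries no eigenvalue labels; its confinement to a
    compact box is what makes the set closed. *)
Definition resonant k : set (R -> R) :=
  [set f | exists l : 'I_n -> R,
    [/\ forall i, ratr (k i).1 <= l i <= ratr (k i).2,
        forall i, shoot L f (l i) L = 0 & \sum_i c i * l i = 0]].

Let box k : set 'rV[R]_n :=
  [set v | forall i, `[ratr (k i).1, ratr (k i).2]%classic (v ord0 i)].

Lemma continuous_shoot f : continuous f -> continuous (fun l => shoot L f l L).
Proof.
move=> cf l; have [S S0 fS] := continuous_bounded L0 cf.
have [A A0 shA] := shooting_lipschitz L0 (S + `|l| + 1).
have fS' x : 0 <= x <= L -> `|f x| <= S + `|l| + 1.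
  by move=> /fS; have := normr_ge0 l; lra.
apply/cvgrPdist_le => e e0; exists (Num.min 1 (e / (A + 1))).
  by rewrite /= lt_min ltr01 divr_gt0// ltr_wpDl.
move=> z /=; rewrite lt_min => /andP[lz1]; rewrite ltr_pdivlMr ?ltr_wpDl// => lze.
have [u yu] := shootP L0 l cf; have [v zv] := shootP L0 z cf.
have zS : `|z| <= S + `|l| + 1.
  have -> : z = l - (l - z) by ring.
  by rewrite (le_trans (ler_normB _ _))//; lra.
have lS : `|l| <= S + `|l| + 1 by lra.
have ff x : 0 <= x <= L -> `|f x - f x| <= `|l - z| by rewrite subrr normr0.
have LL : 0 <= L <= L by rewrite lexx ltW.
have [+ _] := shA _ _ _ _ _ _ _ _ `|l - z| fS' lS fS' zS ff (lexx _) yu zv L LL.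
by move=> /le_trans; apply; have := normr_ge0 (l - z); lra.
Qed.

(** For a non-resonant [f] the defect [phi] is continuous and positive on the compact box, so it has
    a positive minimum, while a tuple resonant for a nearby [g] has small defect for [f]. *)
Lemma resonant_closed k f : continuous f -> ~ resonant k f ->
  exists2 e : R, 0 < e & forall g, continuous g ->
    (forall x, 0 <= x <= L -> `|g x - f x| <= e) -> ~ resonant k g.
Proof.
move=> cf fN.
have [k0|/set0P k0] := eqVneq (box k) set0.
  exists 1 => // g cg gf [l [lk _ _]].
  suff : box k (\row_i l i) by rewrite k0.
  by move=> i /=; rewrite mxE in_itv/= lk.
have cbox : compact (box k).
  apply: (@rV_compact _ _ (fun i => `[ratr (k i).1 : R, ratr (k i).2]%classic)) => i.
  exact: segment_compact.
pose phi (v : 'rV[R]_n) :=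
  \sum_i `|shoot L f (v ord0 i) L| + `|\sum_i c i * v ord0 i|.
have ccoord i : continuous (fun v : 'rV[R]_n => v ord0 i) by exact: coord_continuous.
have cphi : continuous phi.
  move=> v; have FF : Filter (nbhs v) := nbhs_filter v.
  pose D i (w : 'rV[R]_n) := `|shoot L f (w ord0 i) L|.
  have cD i : D i w @[w --> v] --> D i v.
    have H : shoot L f (w ord0 i) L @[w --> v] --> shoot L f (v ord0 i) L.
      exact: (cvg_comp _ _ (ccoord i v) (@continuous_shoot f cf (v ord0 i))).
    exact: cvg_norm H.
  have cl i : c i * w ord0 i @[w --> v] --> c i * v ord0 i.
    by apply: cvgM; [exact: cvg_cst|exact: ccoord].
  apply: cvgD; first exact: cvg_sumr cD.
  by apply: cvg_norm; exact: cvg_sumr cl.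
have phi_ge0 v : 0 <= phi v by rewrite addr_ge0// sumr_ge0.
have [v vk vmin] := EVT_min_rV k0 cbox (continuous_subspaceT cphi).
have phiv : 0 < phi v.
  rewrite lt_neqAle phi_ge0 andbT; apply/negP => /eqP/esym/eqP.
  rewrite paddr_eq0 ?sumr_ge0// psumr_eq0// normr_eq0 => /andP[/allP sh0 /eqP c0].
  apply: fN; exists (fun i => v ord0 i); split=> // i.
    by have /set_mem/(_ i) := vk; rewrite /= in_itv.
  by apply/eqP; rewrite -normr_eq0; apply: sh0; rewrite mem_index_enum.
have [S S0 fS] := continuous_bounded L0 cf.
pose K : R := \sum_i (`|ratr (k i).1| + `|ratr (k i).2|).
have K0 : 0 <= K by apply: sumr_ge0 => i _; rewrite addr_ge0.
have [A A0 shA] := shooting_lipschitz L0 (S + K + 1).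
have nA : 0 < n%:R * A + 1 by rewrite ltr_wpDl// mulr_ge0.
(* Each of the [n] shooting values moves by at most [A * e], so a resonant tuple of [g] would have
   defect at most half the minimum. *)
pose e := Num.min 1 (phi v / 2 / (n%:R * A + 1)).
have e0 : 0 < e by rewrite lt_min ltr01 !divr_gt0.
have [e1 ephi] : e <= 1 /\ e <= phi v / 2 / (n%:R * A + 1).
  by rewrite !ge_min !lexx orbT.
exists e => // g cg gf [l [lk gl cl]].
pose w : 'rV[R]_n := \row_i l i.
have wk : w \in box k by apply/mem_set => i /=; rewrite mxE in_itv/= lk.
have lS i : `|l i| <= S + K + 1.
  have : `|ratr (k i).1| + `|ratr (k i).2| <= K :> R.
    rewrite /K (bigD1 i)//= lerDl; apply: sumr_ge0 => j _; exact: addr_ge0.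
  have /andP[] := lk i; have := ler_norm (- ratr (k i).1 : R).
  have := ler_norm (ratr (k i).2 : R); rewrite normrN ler_norml.
  have := normr_ge0 (ratr (k i).1 : R); have := normr_ge0 (ratr (k i).2 : R).
  by lra.
have fS' x : 0 <= x <= L -> `|f x| <= S + K + 1 by move=> /fS; lra.
have gS' x : 0 <= x <= L -> `|g x| <= S + K + 1.
  move=> xL; have -> : g x = f x + (g x - f x) by ring.
  by rewrite (le_trans (ler_normD _ _))//; have := fS x xL; have := gf x xL; lra.
have fl i : `|shoot L f (l i) L| <= A * e.
  have [u yu] := shootP L0 (l i) cf; have [u' yu'] := shootP L0 (l i) cg.
  have ll : `|l i - l i| <= e by rewrite subrr normr0 ltW.
  have fg x : 0 <= x <= L -> `|f x - g x| <= e by rewrite distrC; exact: gf.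
  have LL : 0 <= L <= L by rewrite lexx ltW.
  have [+ _] := shA _ _ _ _ _ _ _ _ e fS' (lS i) gS' (lS i) fg ll yu yu' L LL.
  by rewrite gl subr0.
have : phi w <= n%:R * A * e.
  rewrite /phi; under [X in `|X|]eq_bigr do rewrite mxE.
  rewrite cl normr0 addr0 -mulrA -[n in n%:R]card_ord -sumr_const mulr_suml.
  by apply: ler_sum => i _; rewrite mxE mul1r fl.
have := vmin w wk.
move: ephi; rewrite ler_pdivlMr// mulrDr mulr1; lra.
Qed.

Definition resonance_patch (p : seq (rat * rat * rat) * rat * {ffun 'I_n -> rat * rat})
  : set (R -> R) := tube L p.1.1 p.1.2 `&` resonant p.2.

Definition isolated_along (b : R) (N : set (R -> R)) := forall f g t,
  continuous f -> continuous g -> N f -> N g ->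
  (forall x, 0 <= x <= L -> g x = f x + t * Num.min x b) -> t = 0.

(** The tube keeps paths, and the box keeps tuples, within the tolerance [e] of
    [resonance_isolated], so any two members of the patch can be compared, whichever tuples in the
    box witness their resonance. *)
Lemma resonance_patch_cover f (l : 'I_n -> R) : continuous f -> injective l ->
  (exists i, c i != 0) -> (forall i, shoot L f (l i) L = 0) ->
  \sum_i c i * l i = 0 ->
  exists p, resonance_patch p f /\ exists b : rat, 0 < (ratr b : R) < L /\
    isolated_along (ratr b) (resonance_patch p).
Proof.
move=> cf linj c0 fl cl.
have [b [bL [e e0 iso]]] := resonance_isolated L0 cf linj c0.
have [s [r [fsr sre]]] := ex_tube L0 cf e0.
have /choice[k kE] : forall i, exists p : rat * rat,
    l i - e < ratr p.1 < l i /\ l i < ratr p.2 < l i + e.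
  move=> i; have /rat_in_itvoo[q1] : l i - e < l i by rewrite ltrBlDr ltrDl.
  have /rat_in_itvoo[q2] : l i < l i + e by rewrite ltrDl.
  by rewrite !in_itv/= => ? ?; exists (q1, q2).
exists (s, r, [ffun i => k i]); split.
  split=> //; exists l; split=> // i.
  by rewrite ffunE; have [/andP[_ ?] /andP[? _]] := kE i; rewrite !ltW.
exists b; split=> // g h t cg ch [gsr [lg [lgk gl clg]]] [hsr [lh [lhk hl clh]]] gh.
apply: (iso g h lg lh t) => //; [exact: sre|exact: sre|move=> i].
have := lgk i; have := lhk i; rewrite ffunE => /andP[? ?] /andP[? ?].
have [/andP[? ?] /andP[? ?]] := kE i.
by rewrite !ler_norml; split; lra.
Qed.

Lemma resonance_patch_measurable p :
  exists A, measurable (A : set (g_sigma_algebraType (cylinder L))) /\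
    forall f, continuous f -> A f <-> resonance_patch p f.
Proof.
have [A [mA AE]] := closed_path_measurable L0 (@resonant_closed p.2).
exists (tube L p.1.1 p.1.2 `&` A); split.
  by apply: measurableI => //; exact: tube_measurable.
by move=> f /AE[AN NA]; split=> -[? ?]; split=> //; [exact: AN|exact: NA].
Qed.

End resonance_set.

(** * Weighted laws and independence *)

Section weighted_integral.
Local Open Scope ereal_scope.
Context {d d' : measure_display} {T : measurableType d} {T' : measurableType d'}
  {R : realType}.
Variables (m : {measure set T -> \bar R}) (v : {measure set T' -> \bar R}).
Variables (X : T -> T') (Y : T -> R).
Hypothesis mX : measurable_fun setT X.
Hypothesis mY : measurable_fun setT Y.
Hypothesis Y0 : forall w, (0 <= Y w)%R.
Hypothesis Yv : forall A, measurable A -> \int[m]_(w in X @^-1` A) (Y w)%:E = v A.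

Import HBNNSimple.

Lemma integral_weighted_nnsfun (h : {nnsfun T' >-> R}) :
  \int[m]_w (h (X w) * Y w)%:E = \int[v]_x (h x)%:E.
Proof.
rewrite integralT_nnsfun sintegralE.
have mhX y : measurable ((h \o X) @^-1` [set y]).
  rewrite -[_ @^-1` _]setTI comp_preimage.
  by apply: mX => //; rewrite -[_ @^-1` _]setTI; exact: measurable_funP.
transitivity (\int[m]_w
    (\sum_(y \in range h) (y * (\1_((h \o X) @^-1` [set y]) w * Y w))%:E)).
  apply: eq_integral => w _; rewrite (fimfunE h (X w)) fsumEFin//.
  rewrite mulr_fsuml//; congr (_%:E); apply: eq_fsbigr => y _.
  by rewrite mulrA !indicE; congr (_ * _%:R * _)%R; apply: congr1; apply: asbool_equiv_eq.
rewrite ge0_integral_fsum//; first last.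
- move=> y w _; rewrite lee_fin; have [y0|y0] := leP 0%R y.
    by rewrite !mulr_ge0.
  suff -> : \1_((h \o X) @^-1` [set y]) w = 0%R :> R by rewrite mul0r mulr0.
  rewrite indicE memNset//= => hy.
  have hX0 : (0 <= h (X w))%R by exact: fun_ge0.
  by move: hX0; rewrite hy leNgt y0.
- move=> y; apply/measurable_EFinP; apply: measurable_funM => //.
  by apply: measurable_funM => //; exact: measurable_indic.
apply: eq_fsbigr => y /set_mem[x _ hx].
have y0 : (0 <= y)%R by rewrite -hx; exact: fun_ge0.
under eq_integral do rewrite EFinM.
have mhY : measurable_fun setT (fun w => (\1_((h \o X) @^-1` [set y]) w * Y w)%:E).
  apply/measurable_EFinP; apply: measurable_funM => //; exact: measurable_indic.
rewrite ge0_integralZl//; last by move=> w _; rewrite lee_fin mulr_ge0.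
congr (_ * _); rewrite -Yv; last by rewrite -[_ @^-1` _]setTI; exact: measurable_funP.
rewrite [RHS]integral_mkcond; apply: eq_integral => w _.
rewrite patchE indicE; have -> : (w \in (h \o X) @^-1` [set y]) = (w \in X @^-1` (h @^-1` [set y])) by [].
by case: ifPn => _; rewrite ?mul1r ?mul0r.
Qed.

(** Monotone limit of the simple case. It is applied with [Y = 1] (image laws), with [X] the
    identity (densities), and with [Y] a product of other factors (independence). *)
Lemma integral_weighted (f : T' -> R) : (forall x, (0 <= f x)%R) ->
  measurable_fun setT f ->
  \int[m]_w (f (X w) * Y w)%:E = \int[v]_x (f x)%:E.
Proof.
move=> f0 mf; have mfE : measurable_fun setT (EFin \o f) by exact/measurable_EFinP.
pose h := nnsfun_approx measurableT mfE.
have fh x : (h n x)%:E @[n --> \oo] --> (f x)%:E.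
  by apply: (@cvg_nnsfun_approx _ _ _ _ measurableT _ mfE) => // y _; rewrite lee_fin.
have nd x : {homo (fun n => h n x) : a b / (a <= b)%N >-> (a <= b)%R}.
  by move=> a b ab; exact/lefP/nd_nnsfun_approx.
have -> : \int[v]_x (f x)%:E = limn (fun n => \int[v]_x (h n x)%:E).
  rewrite -monotone_convergence//.
  - by apply: eq_integral => x _; apply/esym/cvg_lim.
  - by move=> n; apply/measurable_EFinP; exact: measurable_funP.
  - by move=> n x _; rewrite lee_fin.
  - by move=> x _ a b ab; rewrite lee_fin nd.
have -> : \int[m]_w (f (X w) * Y w)%:E = limn (fun n => \int[m]_w (h n (X w) * Y w)%:E).
  rewrite -monotone_convergence//.
  - apply: eq_integral => w _; apply/esym/cvg_lim => //.
    by apply: (@cvgeZr _ _ _ (fun n => (h n (X w))%:E) (f (X w))%:E (Y w)%:E).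
  - move=> n; apply/measurable_EFinP; apply: measurable_funM => //.
    by apply: measurableT_comp => //; exact: measurable_funP.
  - by move=> n w _; rewrite lee_fin mulr_ge0.
  - by move=> w _ a b ab; rewrite lee_fin ler_wpM2r// nd.
by congr (limn _); apply/funext => n; exact: integral_weighted_nnsfun.
Qed.

End weighted_integral.

Section gaussian_shift.
Context {R : realType}.
Local Notation mu := (@lebesgue_measure R).

Lemma lebesgue_measure_shift (a : R) (A : set R) : measurable A ->
  mu ((fun x => x + a) @^-1` A) = mu A.
Proof.
move=> mA.
have mshift : measurable_fun [set: measurableTypeR R] (fun x : measurableTypeR R => (x + a : measurableTypeR R)).
  by apply: measurable_funD => //; exact: measurable_cst.
pose phi : {mfun measurableTypeR R >-> measurableTypeR R} :=
  HB.pack (fun x : measurableTypeR R => (x + a : measurableTypeR R))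
    (isMeasurableFun.Build _ _ _ _ _ mshift).
apply/esym; apply: (@lebesgue_measure_unique R (pushforward mu phi)) => // X.
case=> -[p q] _ <-; rewrite /pushforward/=.
transitivity (mu `](p - a), (q - a)]%classic); last first.
  congr (mu _); apply/seteqP; split=> x /=;
    by rewrite !in_itv/= ltrBlDr lerBrDr.
rewrite !lebesgue_measure_itv/= !lte_fin ltrD2r; case: ifP => // _.
by rewrite -!EFinB; congr (_%:E); ring.
Qed.

(** Completing the square in the Gaussian density. The shift is written [tau * s ^+ 2] because for
    an increment the variance is the time step, so [tau] is the slope of the drift. *)
Lemma normal_prob_shift (s tau : R) (A : set R) : s != 0 -> measurable A ->
  normal_prob 0 s [set x | A (x + tau * s ^+ 2)] =
  (\int[normal_prob 0 s]_x
     (\1_A x * expR (tau * x - tau ^+ 2 * s ^+ 2 / 2))%:E)%E.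
Proof.
move=> s0 mA; set a := tau * s ^+ 2.
pose e (x : R) := expR (tau * x - tau ^+ 2 * s ^+ 2 / 2).
have me : measurable_fun setT e.
  apply: measurableT_comp => //.
  by apply: measurable_funB; [exact: mulrl_measurable|exact: measurable_cst].
pose G (z : R) := \1_A z * e z * normal_pdf 0 s z.
have mG : measurable_fun setT G.
  apply: measurable_funM; last exact: measurable_normal_pdf.
  by apply: measurable_funM => //; exact: measurable_indic.
have G0 z : 0 <= G z.
  by rewrite !mulr_ge0 ?expR_ge0// normal_pdf_ge0.
have mshift : measurable_fun setT (fun x : R => x + a).
  by apply: measurable_funD => //; exact: measurable_cst.
have -> : (\int[normal_prob 0 s]_x (\1_A x * e x)%:E = \int[mu]_z (G z)%:E)%E.
  apply/esym; apply: (@integral_weighted _ _ _ _ R mu (normal_prob 0 s)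
    (fun x : R => x) (normal_pdf 0 s) _ _ _ _ (fun x => \1_A x * e x)) => //.
  - exact: measurable_normal_pdf.
  - by move=> x; exact: normal_pdf_ge0.
  - by move=> x; rewrite mulr_ge0 ?expR_ge0.
  - by apply: measurable_funM => //; exact: measurable_indic.
have -> : (\int[mu]_z (G z)%:E = \int[mu]_x (G (x + a))%:E)%E.
  have := @integral_weighted _ _ _ _ R mu mu (fun x : R => x + a) (cst 1)
    mshift (@measurable_cst _ _ _ _ _ _) _ _ G G0 mG.
  move=> <-//; first by apply: eq_integral => x _; rewrite /= mulr1.
  move=> E mE; have mE' : measurable ((fun x : R => x + a) @^-1` E).
    by rewrite -[_ @^-1` _]setTI; exact: mshift.
  transitivity (\int[mu]_(x in (fun x : R => (x + a)%R) @^-1` E) cst 1%E x)%E => //.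
  by rewrite integral_cst// mul1e; exact: lebesgue_measure_shift.
rewrite /normal_prob integral_mkcond; apply: eq_integral => x _.
rewrite patchE /G indicE.
have -> : (x \in [set x | A (x + a)]) = (x + a \in A) by apply/idP/idP; rewrite !inE.
case: ifP => _; last by rewrite !mul0r.
rewrite mul1r /= !normal_pdfE//; congr (_%:E).
rewrite mulrCA -expRD; congr (_ * expR _).
rewrite /a; field.
by rewrite s0.
Qed.

End gaussian_shift.

Section independence.
Context {d : measure_display} {T : measurableType d} {R : realType}.
Variable P : probability T R.

(** Indicators are replaced by the functions [f i] one coordinate at a time: [g m] uses [f] below
    [m] and indicators from [m] on, and [m = 0] is independence itself. *)
Lemma independent_integral_prod n (X : 'I_n -> {RV P >-> R})
    (f : 'I_n -> R -> R) (F : 'I_n -> R) : independent_rvs P X ->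
  (forall i x, 0 <= f i x) -> (forall i, measurable_fun setT (f i)) ->
  (forall i, \int[P]_w (f i (X i w))%:E = (F i)%:E)%E ->
  (\int[P]_w (\prod_i f i (X i w))%:E = (\prod_i F i)%:E)%E.
Proof.
move=> indX f0 mf fF.
have mXA i (A : set R) : measurable A -> measurable (X i @^-1` A).
  by move=> mA; rewrite -[_ @^-1` _]setTI; exact: measurable_funP.
pose g (m : nat) (A : 'I_n -> set R) (i : 'I_n) (x : R) : R := if (i < m)%N then f i x else \1_(A i) x.
pose G (m : nat) (A : 'I_n -> set R) (i : 'I_n) : R :=
  if (i < m)%N then F i else fine (P (X i @^-1` A i)).
have F0 i : 0 <= F i.
  by rewrite -lee_fin -fF integral_ge0// => w _; rewrite lee_fin.
have mg m A i : measurable (A i) -> measurable_fun setT (g m A i).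
  by move=> mA; rewrite /g; case: (i < m)%N; [exact: mf|exact: measurable_indic].
have g0 m A i x : 0 <= g m A i x by rewrite /g; case: ifP.
have G0 m A i : 0 <= G m A i.
  by rewrite /G; case: ifP => // _; rewrite fine_ge0.
suff main m : (m <= n)%N -> forall A, (forall i, measurable (A i)) ->
    (\int[P]_w (\prod_i g m A i (X i w))%:E = (\prod_i G m A i)%:E)%E.
  have <- : \prod_i G n (fun=> setT) i = \prod_i F i.
    by apply: eq_bigr => i _; rewrite /G ltn_ord.
  rewrite -(main n (leqnn n) (fun=> setT) (fun=> measurableT)); apply: eq_integral => w _; congr (_%:E).
  by apply: eq_bigr => i _; rewrite /g ltn_ord.
have gS (m' : nat) (k : 'I_n) A (i : 'I_n) : i != k -> m' = k ->
    g m'.+1 A i =1 g m' A i /\ G m'.+1 A i = G m' A i.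
  move=> ik mk; rewrite /g /G ltnS leq_eqVlt.
  suff -> : (i == m' :> nat) = false by [].
  by apply/negbTE; rewrite mk.
elim: m => [_ A mA|m IH mn A mA].
  have mI : measurable (\bigcap_(i in [set: 'I_n]) (X i @^-1` A i)).
    by apply: fin_bigcap_measurable => // i _; exact: mXA.
  rewrite /G/= -(indX A mA) -[in RHS](setIT (\bigcap_(i in _) _)).
  rewrite -integral_indic//.
  apply: eq_integral => w _; congr (_%:E); rewrite /g/= indicE.
  have [/set_mem wA|wA] := boolP (w \in _).
    by rewrite big1// => i _; rewrite indicE mem_set//; exact: wA.
  suff [i Ai] : exists i, ~ A i (X i w).
    by rewrite (bigD1 i)//= indicE memNset// mul0r.
  apply: contrapT => noi; move/negP: wA; apply; apply/mem_set => i _.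
  by apply: contrapT => Ai; apply: noi; exists i.
pose k := Ordinal mn.
pose Y w : R := \prod_i (if i != k then g m A i (X i w) else 1).
pose C : R := \prod_(i | i != k) G m A i.
have C0 : 0 <= C by apply: prodr_ge0.
have mY : measurable_fun setT Y.
  apply: measurable_prod => i _; case: (i != k); last exact: measurable_cst.
  by apply: measurableT_comp; [exact: mg|exact: measurable_funP].
have Y0 w : 0 <= Y w by apply: prodr_ge0 => i _; case: ifP.
have YC (E : set R) : measurable E ->
    (\int[P]_(w in X k @^-1` E) (Y w)%:E =
     mscale (NngNum C0) (pushforward P (X k)) E)%E.
  (* With [E] in place [k], the induction hypothesis says that the law of [X k] weighted by the
     other factors is [C] times its own law. *)
  move=> mE; pose AE i := if i == k then E else A i.
  have mAE i : measurable (AE i) by rewrite /AE; case: ifP.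
  have AEE i : i != k -> AE i = A i by rewrite /AE => /negPf ->.
  have AEk : AE k = E by rewrite /AE eqxx.
  have GE : \prod_i G m AE i = fine (P (X k @^-1` E)) * C.
    rewrite (bigD1 k)//= {1}/G ltnn AEk; congr (_ * _).
    by apply: eq_bigr => i ik; rewrite /G AEE.
  have := IH (ltnW mn) AE mAE.
  rewrite GE EFinM fineK ?fin_num_measure//; last exact: mXA.
  rewrite /mscale/= muleC => <-.
  rewrite integral_mkcond; apply: eq_integral => w _.
  rewrite patchE (bigD1 k)//= {1}/g ltnn AEk indicE.
  have -> : (w \in X k @^-1` E) = (X k w \in E) by apply/idP/idP; rewrite !inE.
  case: ifP => _; last by rewrite mul0r.
  rewrite mul1r; congr (_%:E); rewrite /Y -big_mkcond/=.
  by apply: eq_bigr => i ik; rewrite /g AEE.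
have mfE : measurable_fun setT (EFin \o f k) by exact/measurable_EFinP.
have f0E (x : R) : setT x -> (0 <= (EFin \o f k) x)%E by rewrite lee_fin.
have H : (\int[P]_w (f k (X k w) * Y w)%:E = (C * F k)%:E)%E.
  rewrite (integral_weighted (measurable_funP (X k)) mY Y0
    (YC (measurable_funP (X k))) (f0 k) (mf k)).
  have E1 := @ge0_integral_mscale _ _ _ (pushforward P (X k)) _ measurableT
    (NngNum C0) (EFin \o f k) mfE f0E.
  have E2 := @ge0_integral_pushforward _ _ _ _ R _ (measurable_funP (X k)) P setT
    (EFin \o f k) measurableT mfE (fun x _ => f0E x I).
  rewrite [LHS]E1 [X in (_ * X)%E]E2 preimage_setT.
  by rewrite [X in (_ * X)%E]fF EFinM.
rewrite [in RHS](bigD1 k)//= {1}/G/= ltnSn mulrC.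
rewrite (eq_bigr (G m A)); last first.
  by move=> i ik; have [_] := gS m k A i ik erefl.
rewrite -/C -H; apply: eq_integral => w _; congr (_%:E).
rewrite (bigD1 k)//= {1}/g ltnSn; congr (_ * _).
rewrite /Y -big_mkcond/=; apply: eq_bigr => i ik.
by have [->] := gS m k A i ik erefl.
Qed.

End independence.

(** * The Cameron-Martin formula *)

Section shifted_law.
Context {d : measure_display} {T : measurableType d} {R : realType}.
Variables (P : probability T R) (D : T -> R).
Hypothesis mD : measurable_fun setT D.
Hypothesis D0 : forall w, 0 <= D w.
Context {S : Type}.
Variables X X' : T -> S.

(** On [A], the law of [X'] has density [D] relative to the law of [X]. Measurability of the
    preimages is included so that the property passes to complements and disjoint unions. *)
Definition shifted_law (A : set S) : Prop :=
  [/\ measurable (X @^-1` A), measurable (X' @^-1` A) &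
      P (X' @^-1` A) = (\int[P]_(w in X @^-1` A) (D w)%:E)%E].

Lemma shifted_law_sigma (G : set (set S)) : setI_closed G -> shifted_law setT ->
  (forall A, G A -> shifted_law A) -> forall A, <<s G >> A -> shifted_law A.
Proof.
move=> GI HT GH; apply: lambda_system_subset => //.
apply/dynkin_lambda_system; split=> // [A [mA mA' PA]|F tF FH].
  split; [by rewrite preimage_setC; exact: measurableC
         |by rewrite preimage_setC; exact: measurableC|].
  (* The case of the full set says that [D] has total mass 1, which complements require. *)
  have [_ _ PT] := HT; rewrite (preimage_setT X) (preimage_setT X') probability_setT in PT.
  have X'C : X' @^-1` (~` A) = ~` (X' @^-1` A) by [].
  have XC : X @^-1` (~` A) = ~` (X @^-1` A) by [].
  rewrite X'C XC probability_setC// PA.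
  have E : (\int[P]_w (D w)%:E = \int[P]_(w in X @^-1` A) (D w)%:E +
      \int[P]_(w in ~` (X @^-1` A)) (D w)%:E)%E.
    rewrite -ge0_integral_setU ?setUv//.
    - exact: measurableC.
    - exact/measurable_EFinP.
    - by move=> w _; rewrite lee_fin.
    - by apply/disj_setPCl.
  have fin : (\int[P]_(w in X @^-1` A) (D w)%:E)%E \is a fin_num.
    by rewrite -PA fin_num_measure.
  by rewrite PT E addeAC subee// add0e.
split.
- by rewrite preimage_bigcup; apply: bigcup_measurable => k _; have [] := FH k.
- by rewrite preimage_bigcup; apply: bigcup_measurable => k _; have [] := FH k.
- have XU : X @^-1` (\bigcup_k F k) = \bigcup_k (X @^-1` F k).
    exact: preimage_bigcup.
  have X'U : X' @^-1` (\bigcup_k F k) = \bigcup_k (X' @^-1` F k).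
    exact: preimage_bigcup.
  rewrite XU X'U measure_bigcup//; last 2 first.
  + by move=> k _; have [] := FH k.
  + by apply/trivIsetP => i j _ _ ij; rewrite -preimage_setI;
      move/trivIsetP : tF => /(_ i j I I ij) ->; rewrite preimage_set0.
  rewrite eseries_mkcond ge0_integral_bigcup//.
  + by apply: eq_eseriesr => k _; rewrite in_setT; have [] := FH k.
  + by move=> k; have [] := FH k.
  + exact/measurable_funTS/measurable_EFinP.
  + by move=> w _; rewrite lee_fin.
  + by apply/trivIsetP => i j _ _ ij; rewrite -preimage_setI;
      move/trivIsetP : tF => /(_ i j I I ij) ->; rewrite preimage_set0.
Qed.

End shifted_law.

Section cameron_martin.
Context {d : measure_display} {T : measurableType d} {R : realType}.
Variables (P : probability T R) (B : R -> {RV P >-> R}).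
Hypothesis BM : brownian_motion B.
Variables (rho b tau : R).
Hypothesis b0 : 0 < b.
Hypothesis bpi : b <= pi.
Local Notation pi := (@pi R).

Definition scaled_path (w : T) : R -> R := fun x => rho * B (clamp pi x) w.

Definition shifted_path (w : T) : R -> R :=
  fun x => rho * (B (clamp pi x) w + tau * Num.min (clamp pi x) b).

(** The drift has slope [tau] up to [b] and 0 afterwards, so the usual exponential martingale
    reduces to its value at time [b]. *)
Definition density (w : T) : R := expR (tau * B b w - tau ^+ 2 * b / 2).

Lemma measurable_density : measurable_fun setT density.
Proof.
apply: measurableT_comp => //; apply: measurable_funB; last exact: measurable_cst.
by apply: measurableT_comp; [exact: mulrl_measurable|exact: measurable_funP].
Qed.

Lemma density_ge0 w : 0 <= density w.
Proof. exact: expR_ge0. Qed.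

Local Notation law_shift := (shifted_law P density scaled_path shifted_path).

Section boxes.
Variables (t : nat -> R) (n m : nat).
Hypothesis t0 : t 0%N = 0.
Hypothesis tS : forall i, (i < n)%N -> t i < t i.+1.
Hypothesis tn : t n <= pi.
Hypothesis mn : (m <= n)%N.
Hypothesis tm : t m = b.

Definition increment_box : set (set (R -> R)) :=
  [set A | exists E : 'I_n -> set R, (forall i, measurable (E i)) /\
     A = [set f | forall i : 'I_n, E i (f (t i.+1) - f (t i))]].

Let t_le i j : (i <= j <= n)%N -> t i <= t j.
Proof.
elim: j => [|j IH] /andP[]; first by rewrite leqn0 => /eqP ->.
rewrite leq_eqVlt => /predU1P[->//|ij] jn.
rewrite ltnS in ij.
by apply: (le_trans (IH _)); [rewrite ij ltnW|apply/ltW/tS].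
Qed.

Let t_pi i : (i <= n)%N -> 0 <= t i <= pi.
Proof. by move=> i_n; rewrite -[leLHS]t0 t_le//= (le_trans _ tn)// t_le// i_n leqnn. Qed.

Let inc (i : 'I_n) : {RV P >-> R} := B (t i.+1) \- B (t i).

Let v (i : 'I_n) : R := t i.+1 - t i.

Let v0 i : 0 < v i.
Proof. by rewrite subr_gt0 tS. Qed.

Let tau_ (i : 'I_n) : R := if (i < m)%N then tau else 0.

Let minE (i : 'I_n) : tau * Num.min (t i.+1) b - tau * Num.min (t i) b = tau_ i * v i.
Proof.
rewrite /tau_ /v -tm; case: ltnP => im.
  have h1 : t i.+1 <= t m by rewrite t_le// im.
  have h2 : t i <= t m by rewrite t_le// (ltnW im).
  by rewrite (min_idPl h1) (min_idPl h2); ring.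
have h1 : t m <= t i.+1 by rewrite t_le// leqW//=.
have h2 : t m <= t i by rewrite t_le// im ltnW.
by rewrite (min_idPr h1) (min_idPr h2); ring.
Qed.

Let scaled_inc w (i : 'I_n) :
  scaled_path w (t i.+1) - scaled_path w (t i) = rho * inc i w.
Proof.
rewrite /scaled_path !clampE ?t_pi//; last by rewrite ltnW.
by rewrite /inc/=; ring.
Qed.

Let shifted_inc w (i : 'I_n) :
  shifted_path w (t i.+1) - shifted_path w (t i) = rho * (inc i w + tau_ i * v i).
Proof.
rewrite -minE /shifted_path !clampE ?t_pi//; last by rewrite ltnW.
by rewrite /inc/=; ring.
Qed.

Let e (i : 'I_n) (x : R) := expR (tau_ i * x - tau_ i ^+ 2 * v i / 2).

(** Since [b] is the partition point [t m] and [B 0 = 0], the increments before [b] telescope to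
    [B b] and the time steps to [b]. *)
Let densityE w : density w = \prod_i e i (inc i w).
Proof.
rewrite /density /e -expR_sum; congr expR.
pose F (f : nat -> R) k : R := if (k < m)%N then f k.+1 - f k else 0.
have sumF f : \sum_(i < n) F f i = f m - f 0%N.
  rewrite -(telescope_sumr _ (leq0n m)) big_mkord.
  rewrite (big_ord_widen n (fun k => f k.+1 - f k) mn) [RHS]big_mkcond/=.
  by [].
have -> : B b w = \sum_(i < n) F (fun k => B (t k) w) i.
  by rewrite sumF tm t0 (brownian0 BM) subr0.
have -> : b = \sum_(i < n) F t i by rewrite sumF tm t0 subr0.
rewrite mulr_sumr mulr_sumr mulr_suml -sumrB; apply: eq_bigr => i _.
rewrite /F /tau_ /v /inc; case: ifP => _ /=; ring.
Qed.

Let me i : measurable_fun setT (e i).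
Proof.
apply: measurableT_comp => //.
by apply: measurable_funB; [exact: mulrl_measurable|exact: measurable_cst].
Qed.

(** The drift changes each increment by the constant [tau_ i * v i]. The Gaussian shift formula
    treats each increment separately, and independence multiplies the results into [density]. *)
Lemma increment_box_shifted A : increment_box A -> law_shift A.
Proof.
move=> [E [mE ->]].
pose E' i : set R := [set x | E i (rho * x)].
have mE' i : measurable (E' i).
  by rewrite -[E' i]setTI; exact: mulrl_measurable.
pose E'' i : set R := [set x | E' i (x + tau_ i * v i)].
have mE'' i : measurable (E'' i).
  rewrite -[E'' i]setTI; apply: measurable_funD => //; exact: measurable_cst.
have mXA i (A' : set R) : measurable A' -> measurable (inc i @^-1` A').
  by move=> mA; rewrite -[_ @^-1` _]setTI; exact: measurable_funP.
have XE : scaled_path @^-1` [set f | forall i : 'I_n, E i (f (t i.+1) - f (t i))] =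
    \bigcap_(i in [set: 'I_n]) (inc i @^-1` E' i).
  apply/seteqP; split=> w.
    by move=> wE i _; have := wE i; rewrite scaled_inc.
  by move=> wE i; rewrite scaled_inc; exact: wE i I.
have X'E : shifted_path @^-1` [set f | forall i : 'I_n, E i (f (t i.+1) - f (t i))] =
    \bigcap_(i in [set: 'I_n]) (inc i @^-1` E'' i).
  apply/seteqP; split=> w.
    by move=> wE i _; have := wE i; rewrite shifted_inc.
  by move=> wE i; rewrite shifted_inc; exact: wE i I.
have indep : independent_rvs P inc.
  apply: (brownian_independent BM) => //; by rewrite t0.
have mX : measurable (\bigcap_(i in [set: 'I_n]) (inc i @^-1` E' i)).
  by apply: fin_bigcap_measurable => // i _; exact: mXA.
have mX' : measurable (\bigcap_(i in [set: 'I_n]) (inc i @^-1` E'' i)).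
  by apply: fin_bigcap_measurable => // i _; exact: mXA.
rewrite /shifted_law XE X'E; split=> //.
rewrite (indep _ mE'').
pose f i (x : R) := \1_(E' i) x * e i x.
have f0 i x : 0 <= f i x by rewrite mulr_ge0 ?expR_ge0.
have mf i : measurable_fun setT (f i).
  by apply: measurable_funM => //; exact: measurable_indic.
have law i (A' : set R) : measurable A' ->
    P (inc i @^-1` A') = normal_prob 0 (Num.sqrt (v i)) A'.
  move=> mA'; have /andP[ti0 _] : 0 <= t i <= pi by rewrite t_pi// ltnW.
  have /andP[_ ti1] : 0 <= t i.+1 <= pi by rewrite t_pi.
  exact: (brownian_gaussian BM ti0 (tS (ltn_ord i)) ti1 mA').
have F i : (\int[P]_w (f i (inc i w))%:E = (fine (P (inc i @^-1` E'' i)))%:E)%E.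
  rewrite fineK ?fin_num_measure//; last exact: mXA.
  have s0 : Num.sqrt (v i) != 0 by rewrite gt_eqF// sqrtr_gt0.
  have := normal_prob_shift (tau_ i) s0 (mE' i).
  rewrite sqr_sqrtr ?ltW// law// => ->.
  have := @integral_weighted _ _ _ _ R P (normal_prob 0 (Num.sqrt (v i))) (inc i)
    (cst 1) (measurable_funP (inc i)) (@measurable_cst _ _ _ _ _ _) _ _ (f i) (f0 i) (mf i).
  move=> <-//; first by apply: eq_integral => w _; rewrite /= mulr1.
  move=> A' mA'; transitivity (\int[P]_(w in inc i @^-1` A') cst 1%E w)%E => //.
  have mm := mXA i _ mA'; rewrite integral_cst// mul1e.
  exact: law.
rewrite -(independent_integral_prod indep f0 mf F) [RHS]integral_mkcond.
apply: eq_integral => w _; rewrite patchE.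
have [/set_mem wX|wX] := boolP (w \in _).
  rewrite densityE; congr (_%:E); apply: eq_bigr => i _.
  by rewrite /f indicE mem_set ?mul1r//; exact: wX.
suff [i Ei] : exists i, ~ E' i (inc i w).
  by rewrite (bigD1 i)//= /f indicE memNset// !mul0r.
apply: contrapT => noi; move/negP: wX; apply; apply/mem_set => i _.
by apply: contrapT => Ei; apply: noi; exists i.
Qed.

Lemma increment_box_sigma A : <<s increment_box >> A -> law_shift A.
Proof.
apply: shifted_law_sigma.
- exact: measurable_density.
- exact: density_ge0.
- move=> _ _ [E [mE ->]] [E' [mE' ->]]; exists (fun i => E i `&` E' i); split.
    by move=> i; exact: measurableI.
  apply/seteqP; split=> f.
    by move=> [fE fE'] i; split; [exact: fE|exact: fE'].
  by move=> fEE; split=> i; have [] := fEE i.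
- apply: increment_box_shifted; exists (fun=> setT); split=> //.
  by apply/seteqP; split.
- exact: increment_box_shifted.
Qed.

End boxes.

End cameron_martin.

Section finite_cylinders.
Context {d : measure_display} {T : measurableType d} {R : realType}.
Variables (P : probability T R) (B : R -> {RV P >-> R}).
Hypothesis BM : brownian_motion B.
Variables (rho b tau : R).
Hypothesis b0 : 0 < b.
Hypothesis bpi : b <= pi.
Local Notation pi := (@pi R).
Local Notation law_shift :=
  (shifted_law P (density B b tau) (scaled_path B rho) (shifted_path B rho b tau)).

Definition finite_cylinder : set (set (R -> R)) :=
  [set A | exists n (x : 'I_n -> R) (E : 'I_n -> set R),
    [/\ forall i, 0 <= x i <= pi, forall i, measurable (E i) &
        A = [set f | forall i, E i (f (x i))]]].

(** Sorting the given times together with 0, where the paths start, and [b], where the drift has its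
    kink. *)
Lemma ex_partition n (x : 'I_n -> R) : (forall i, 0 <= x i <= pi) ->
  exists N (t : nat -> R) (m : nat) (k : 'I_n -> nat),
  [/\ t 0%N = 0, forall i, (i < N)%N -> t i < t i.+1, t N <= pi &
      [/\ (m <= N)%N, t m = b, forall i, (k i <= N)%N & forall i, t (k i) = x i]].
Proof.
move=> xpi.
pose s := sort <=%R (undup (0 :: b :: codom x)).
have ss : sorted <%R s.
  by rewrite lt_sorted_uniq_le sort_uniq undup_uniq sort_le_sorted.
have mem_s z : (z \in s) = (z \in 0 :: b :: codom x) by rewrite mem_sort mem_undup.
have s_pi z : z \in s -> 0 <= z <= pi.
  rewrite mem_s !inE => /orP[/eqP ->|/orP[/eqP ->|/codomP[i ->]]].
  - by rewrite lexx pi_ge0.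
  - by rewrite ltW.
  - exact: xpi.
have s0 : 0 \in s by rewrite mem_s inE eqxx.
have size_s : (0 < size s)%N by case: (s) s0.
pose t i := nth pi s i.
have tlt i j : (i < j)%N -> (j < size s)%N -> t i < t j.
  move=> ij js; rewrite /t (lt_sorted_ltn_nth pi ss) ?inE//.
  exact: ltn_trans ij js.
have idx z : z \in s -> (index z s <= (size s).-1)%N.
  by rewrite -index_mem => zs; rewrite -ltnS prednK.
have tidx z : z \in s -> t (index z s) = z by move=> zs; rewrite /t nth_index.
have bs : b \in s by rewrite mem_s !inE eqxx orbT.
have xs i : x i \in s by rewrite mem_s !inE codom_f !orbT.
exists (size s).-1, t, (index b s), (fun i => index (x i) s); split.
- apply/le_anti/andP; split; last by have /andP[] := s_pi _ (mem_nth pi size_s).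
  rewrite -[leRHS](tidx 0 s0).
  have [->//|i0] := posnP (index 0 s).
  by apply/ltW/tlt => //; rewrite index_mem.
- by move=> i iN; apply: tlt => //; rewrite -[size s]prednK// ltnS.
- by have /s_pi/andP[] : t (size s).-1 \in s by rewrite mem_nth// prednK.
- split; [exact: idx|exact: tidx|by move=> i; exact: idx|by move=> i; exact: tidx].
Qed.

Lemma finite_cylinder_shifted A : finite_cylinder A -> law_shift A.
Proof.
move=> [n [x [E [xpi mE ->]]]].
have [N [t [m [k [t0 tS tN [mN tm kN kx]]]]]] := ex_partition xpi.
pose S (j : nat) (f : R -> R) : R := \sum_(i < N | (i < j)%N) (f (t i.+1) - f (t i)).
(* A cylinder is not an event of increments, as these ignore [f 0]; but both path maps start at 0,
   so [A'] has the same preimages. *)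
pose A' := [set f : R -> R | forall i, E i (S (k i) f)].
have SE f i : S (k i) f = f (x i) - f 0.
  rewrite /S -(big_ord_widen N (fun i => f (t i.+1) - f (t i)) (kN i)).
  by rewrite -(big_mkord xpredT (fun i => f (t i.+1) - f (t i))) telescope_sumr// kx t0.
have clamp0 : clamp pi 0 = 0 by rewrite clampE ?pi_gt0// lexx pi_ge0.
have eqX (X : T -> R -> R) : (forall w, X w 0 = 0) ->
    X @^-1` [set f | forall i, E i (f (x i))] = X @^-1` A'.
  move=> X0; apply/seteqP; split=> w /= wE i; have := wE i;
    by rewrite SE X0 subr0.
have X0 w : scaled_path B rho w 0 = 0.
  by rewrite /scaled_path clamp0 (brownian0 BM) mulr0.
have X'0 w : shifted_path B rho b tau w 0 = 0.
  rewrite /shifted_path clamp0 (brownian0 BM) (min_idPl (ltW b0)).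
  by rewrite mulr0 addr0 mulr0.
rewrite /shifted_law (eqX _ X0) (eqX _ X'0).
apply: (increment_box_sigma BM rho tau t0 tS tN mN tm).
have mS j : measurable_fun [set: g_sigma_algebraType (increment_box t N)] (S j).
  have -> : S j = (fun f => \sum_(i < N) if (i < j)%N then f (t i.+1) - f (t i) else 0).
    by apply/funext => f; rewrite /S big_mkcond.
  apply: measurable_sum => i; case: (i < j)%N; last exact: measurable_cst.
  move=> _ Y mY; rewrite setTI; apply: sub_sigma_algebra.
  exists (fun i' => if i' == i then Y else setT); split.
    by move=> i'; case: ifP.
  apply/seteqP; split=> f /=.
    by move=> fY i'; case: ifPn => // /eqP ->.
  by move=> /(_ i); rewrite eqxx.
have -> : A' = \bigcap_(i in [set: 'I_n]) (S (k i) @^-1` E i).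
  by apply/seteqP; split=> f; [move=> fA i _; exact: fA|move=> fA i; exact: fA].
suff : measurable (\bigcap_(i in [set: 'I_n]) (S (k i) @^-1` E i) :
  set (g_sigma_algebraType (increment_box t N))) by [].
apply: fin_bigcap_measurable => // i _.
by rewrite -[_ @^-1` _]setTI; exact: mS.
Qed.

Theorem cameron_martin A : <<s cylinder pi >> A -> law_shift A.
Proof.
(* Cylinders at a single time are not stable under intersection, as Dynkin's argument needs; finite
   ones are, and they generate at least as many sets. *)
move=> cA; have {cA} : <<s finite_cylinder >> A.
  apply: smallest_sub cA; first exact: smallest_sigma_algebra.
  move=> _ [x [E [xpi mE ->]]]; apply: sub_sigma_algebra.
  exists 1%N, (fun=> x), (fun=> E); split=> //.
  by apply/seteqP; split=> f; [move=> fE i; exact: fE|move=> /(_ ord0)].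
apply: shifted_law_sigma.
- exact: measurable_density.
- exact: density_ge0.
- move=> _ _ [n [x [E [xpi mE ->]]]] [n' [x' [E' [xpi' mE' ->]]]].
  exists (n + n')%N, (fun i : 'I_(n + n') => match fintype.split i with inl j => x j | inr j => x' j end),
    (fun i : 'I_(n + n') => match fintype.split i with inl j => E j | inr j => E' j end); split.
  + by move=> i; case: fintype.split.
  + by move=> i; case: fintype.split.
  + apply/seteqP; split=> f.
      by move=> [fE fE'] i; case: fintype.split => j; [exact: fE|exact: fE'].
    move=> fEE; split=> i.
      by have := fEE (lshift n' i); rewrite (unsplitK (inl i)).
    by have := fEE (rshift n i); rewrite (unsplitK (inr i)).
- apply: finite_cylinder_shifted.
  exists 0%N, (fun=> 0), (fun=> setT); split=> //; first by case.
  by apply/seteqP; split.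
- exact: finite_cylinder_shifted.
Qed.

End finite_cylinders.

(** * Isolated sets of paths are null *)

Section isolated_null.
Context {d : measure_display} {T : measurableType d} {R : realType}.
Variables (P : probability T R) (B : R -> {RV P >-> R}).
Hypothesis BM : brownian_motion B.
Variables (rho b : R).
Hypothesis rho0 : rho != 0.
Hypothesis b0 : 0 < b.
Hypothesis bpi : b <= pi.
Local Notation pi := (@pi R).

Lemma continuous_brownian w : continuous (fun x => B (clamp pi x) w).
Proof.
have pi0 := pi_gt0 R.
move=> x; apply/cvgrPdist_le => e e0.
have xpi : `[0, pi]%classic (clamp pi x) by rewrite /= in_itv/= clamp_itv.
have cB : {within `[0, pi], continuous (fun x => B x w)}.
  exact: (brownian_continuous BM).
have /subspace_continuousP/(_ _ xpi)/cvgrPdist_le/(_ e e0) := cB.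
move=> [r /= r0 rB]; exists r => //= z xz; apply: rB.
  exact: le_lt_trans (clamp_dist pi0 _ _) xz.
by rewrite /= in_itv/= clamp_itv.
Qed.

Lemma scaled_path_continuous w : continuous (scaled_path B rho w).
Proof.
by move=> x; apply: cvgM; [exact: cvg_cst|exact: continuous_brownian].
Qed.

Lemma shifted_path_continuous tau w : continuous (shifted_path B rho b tau w).
Proof.
move=> x; apply: cvgM; first exact: cvg_cst.
apply: cvgD; first exact: continuous_brownian.
apply: cvgM; first exact: cvg_cst.
have pi0 := pi_gt0 R.
apply/cvgrPdist_le => e e0; exists e => //= z xz.
have minP (a c : R) : `|Num.min a b - Num.min c b| <= `|a - c|.
  have := ler_norm (a - c); have := ler_norm (c - a); rewrite (distrC c).
  by rewrite !minEle ler_norml; case: (leP a b); case: (leP c b) => *; lra.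
by rewrite (le_trans (minP _ _))// (le_trans (clamp_dist pi0 _ _))// ltW.
Qed.

Lemma isolated_along_null (A N : set (R -> R)) : <<s cylinder pi >> A ->
  (forall f, continuous f -> A f <-> N f) -> isolated_along pi b N ->
  P (scaled_path B rho @^-1` A) = 0%E.
Proof.
move=> cA AN iso.
(* Distinct shifts in [[0, 1]]: distinct for disjointness, bounded for a common lower bound on the
   densities. *)
pose tt (j : nat) : R := j.+1%:R^-1.
have CM j := cameron_martin BM rho (tt j) b0 bpi cA.
have [mA _ _] := CM 0%N.
set X := scaled_path B rho @^-1` A in mA *.
pose Om j := shifted_path B rho b (tt j) @^-1` A.
have mOm j : measurable (Om j) by have [] := CM j.
have tt01 j : 0 <= tt j <= 1.
  by rewrite /tt invr_ge0 ler0n/= invf_le1// ler1n.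
have trivOm : trivIset setT Om.
  move=> i j _ _ [w [wi wj]].
  have Ni : N (shifted_path B rho b (tt i) w).
    by apply/AN => //; exact: shifted_path_continuous.
  have Nj : N (shifted_path B rho b (tt j) w).
    by apply/AN => //; exact: shifted_path_continuous.
  have := iso _ _ (rho * (tt j - tt i)) (@shifted_path_continuous (tt i) w)
    (@shifted_path_continuous (tt j) w) Ni Nj.
  have shiftE x : 0 <= x <= pi -> shifted_path B rho b (tt j) w x =
      shifted_path B rho b (tt i) w x + rho * (tt j - tt i) * Num.min x b.
    by move=> xpi; rewrite /shifted_path clampE//; ring.
  move=> /(_ shiftE)/eqP; rewrite mulf_eq0 (negPf rho0)/= subr_eq0 /tt.
  by move=> /eqP/invr_inj/eqP; rewrite eqr_nat => /eqP[].
(* A positive function below every density with parameter in [[0, 1]]. Its integral [a] over [X] is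
   at most the probability of each of the disjoint events [Om j]. *)
pose g (w : T) : R := expR (- (`|B b w| + b / 2)).
have mg : measurable_fun setT g.
  apply: measurableT_comp => //; apply: measurableT_comp => //.
  apply: measurable_funD; last exact: measurable_cst.
  by apply: measurableT_comp => //; exact: measurable_funP.
have g0 w : 0 < g w by exact: expR_gt0.
have gD j w : g w <= density B b (tt j) w.
  rewrite /g /density ler_expR; have /andP[t0 t1] := tt01 j.
  have : - `|B b w| <= tt j * B b w.
    rewrite lerNl -mulrN (le_trans (ler_norm _))// normrM normrN ger0_norm//.
    by rewrite ler_piMl.
  have : tt j ^+ 2 * b <= b by rewrite ler_piMl ?(ltW b0)// expr_le1.
  by lra.
set a := (\int[P]_(w in X) (g w)%:E)%E.
have a_ge0 : (0 <= a)%E by apply: integral_ge0 => w _; rewrite lee_fin ltW.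
have aOm j : (a <= P (Om j))%E.
  have [_ _ ->] := CM j.
  have h1 : measurable_fun X (EFin \o g).
    exact/measurable_funTS/measurable_EFinP.
  have h2 : measurable_fun X (EFin \o density B b (tt j)).
    exact/measurable_funTS/measurable_EFinP/measurable_density.
  apply: ge0_le_integral => //= w _; rewrite lee_fin ?density_ge0 ?gD//.
  exact: ltW.
have a0 : a = 0%E.
  apply/eqP; rewrite eq_le a_ge0 andbT leNgt; apply/negP => a_gt0.
  have afin : a \is a fin_num.
    rewrite ge0_fin_numE// (le_lt_trans (aOm 0%N))//.
    by rewrite (le_lt_trans (probability_le1 _ _))// ltry.
  have na n : (n%:R * fine a <= 1)%R.
    have sumE : ((n%:R * fine a)%:E = \sum_(i < n) a)%E.
      have aE : a = (fine a)%:E by rewrite fineK.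
      by rewrite [in RHS]aE sumEFin sumr_const card_ord mulr_natl.
    rewrite -lee_fin sumE.
    apply: (@le_trans _ _ (\sum_(i < n) P (Om i))%E); first exact: lee_sum.
    rewrite -(@measure_semi_additive_ord_I _ _ _ P Om)//.
    - by apply: probability_le1; exact: bigsetU_measurable.
    - by apply: sub_trivIset trivOm.
    - exact: bigsetU_measurable.
  have fa0 : 0 < fine a by rewrite fine_gt0// a_gt0 -ge0_fin_numE.
  have := na (Num.truncn (fine a)^-1).+1.
  rewrite -ler_pdivlMr// mul1r leNgt.
  by rewrite truncnS_gt.
have : ae_eq P X (EFin \o g) (cst 0%E).
  apply/ae_eq_integral_abs => //.
    exact/measurable_funTS/measurable_EFinP.
  rewrite -[RHS]a0; apply: eq_integral => w _.
  by rewrite /= gtr0_norm.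
move=> [Z [mZ PZ XZ]]; apply/eqP; rewrite eq_le measure_ge0 andbT -PZ.
apply: le_measure; rewrite ?inE// => w wX; apply: XZ => /= /(_ wX)[gw].
by have := g0 w; rewrite gw ltxx.
Qed.

End isolated_null.

(** * Assembly *)

Section assembly.
Context {d : measure_display} {T : measurableType d} {R : realType}.
Variable P : probability T R.

Lemma measure0_bigcup_countable (I : countType) (F : I -> set T) :
  (forall i, measurable (F i)) -> (forall i, P (F i) = 0%E) ->
  measurable (\bigcup_i F i) /\ P (\bigcup_i F i) = 0%E.
Proof.
move=> mF F0; have mU : measurable (\bigcup_i F i).
  by apply: countable_bigcupT_measurable => //; exact: countableP.
split=> //; apply: measure_negligible => //.
pose G (k : nat) := if @choice.unpickle I k is Some i then F i else set0.
have -> : \bigcup_i F i = \bigcup_k G k.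
  apply/seteqP; split=> [w [i _ Fi]|w [k _]].
    by exists (choice.pickle i) => //; rewrite /G choice.pickleK.
  by rewrite /G; case: choice.unpickle => // i Fi; exists i.
apply: negligible_bigcup => k; rewrite /G; case: choice.unpickle => [i|].
  by apply/negligibleP => //; exact: F0.
exact: negligible_set0.
Qed.

(** Allows the Brownian path to be replaced by its clamped version, which is continuous on the whole
    line. *)
Lemma dirichlet_eigenvalue_eq (s s' : R -> R) l :
  (forall x, x \in `]0, pi[ -> s x = s' x) ->
  dirichlet_eigenvalue s l -> dirichlet_eigenvalue s' l.
Proof.
move=> ss' [y y0 [yL2 lyL2 yac ybd [u [uac yu] ul]]].
exists y => //; split=> //; exists u.
  split=> //; apply: (ae_imp _ yu) => x xu xpi.
  by rewrite -ss'//; exact: xu.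
by apply: (ae_imp _ ul) => x xu xpi; rewrite -ss'//; exact: xu.
Qed.

Lemma sum_finsupp_ord (c : {fsfun nat -> int with 0}) (F : nat -> R) (N : nat) :
  (forall n, n \in finsupp c -> (n < N)%N) ->
  \sum_(n <- finsupp c) (c n)%:~R * F n = \sum_(i < N) (c i)%:~R * F i.
Proof.
move=> cN; rewrite -(big_mkord xpredT (fun i => (c i)%:~R * F i)).
rewrite [RHS](bigID [pred n | n \in finsupp c])/=.
rewrite [X in _ = _ + X]big1 ?addr0; last first.
  by move=> i; rewrite memNfinsupp => /eqP ->; rewrite mul0r.
rewrite -[RHS]big_filter; apply: perm_big; apply: uniq_perm.
- exact: fset_uniq.
- by rewrite filter_uniq// iota_uniq.
- move=> n; rewrite mem_filter mem_index_iota leq0n/=.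
  by have [/cN ->|] := boolP (n \in finsupp c).
Qed.

Variable B : R -> {RV P >-> R}.
Hypothesis BM : brownian_motion B.
Variable rho : R.
Hypothesis rho0 : rho != 0.
Local Notation pi := (@pi R).

Let patch_set n (c : 'I_n -> R) p : set (R -> R) :=
  sval (cid (resonance_patch_measurable (pi_gt0 R) c p)).

Let patch_setP n (c : 'I_n -> R) p :
  <<s cylinder pi >> (patch_set c p) /\
  forall f, continuous f -> patch_set c p f <-> resonance_patch pi c p f.
Proof. exact: (svalP (cid (resonance_patch_measurable (pi_gt0 R) c p))). Qed.

Let isolated n (c : 'I_n -> R) p := exists b : rat, 0 < (ratr b : R) < pi /\
  isolated_along pi (ratr b) (resonance_patch pi c p).

(** One null set serves all paths and all tuples [l], so no measurable choice of eigenvalues is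
    made. Patches that are not isolated contribute the empty set; the isolated ones already
    cover. *)
Lemma resonance_null n (c : 'I_n -> R) : exists Z : set T,
  [/\ measurable Z, P Z = 0%E & (exists i, c i != 0) ->
    forall w (l : 'I_n -> R), injective l ->
    (forall i, shoot pi (scaled_path B rho w) (l i) pi = 0) ->
    \sum_i c i * l i = 0 -> Z w].
Proof.
pose Z p : set T := if `[<isolated c p>] then scaled_path B rho @^-1` patch_set c p
  else set0.
have ZP p : measurable (Z p) /\ P (Z p) = 0%E.
  rewrite /Z; case: asboolP => [[b [/andP[b0 bpi] iso]]|_]; last first.
    by split; [exact: measurable0|exact: measure0].
  have [cA AN] := patch_setP c p.
  split; last exact: (isolated_along_null BM rho0 b0 (ltW bpi) cA AN iso).
  (* The Cameron-Martin statement is used here with zero drift, only for the measurability of the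
     preimage. *)
  by have [] := cameron_martin BM rho 0 b0 (ltW bpi) cA.
have [mZ PZ] := measure0_bigcup_countable (fun p => (ZP p).1) (fun p => (ZP p).2).
exists (\bigcup_p Z p); split=> // c0 w l linj lw cl.
have [p [pw iso]] := resonance_patch_cover (pi_gt0 R)
  (@scaled_path_continuous _ _ _ _ _ BM rho w) linj c0 lw cl.
exists p => //; rewrite /Z asboolT//.
apply/(patch_setP c p).2 => //.
exact: scaled_path_continuous.
Qed.

Lemma dirichlet_enumeration_shoot (lam : nat -> R) w :
  dirichlet_enumeration (fun x => rho * B x w) lam ->
  forall n, shoot pi (scaled_path B rho w) (lam n) pi = 0.
Proof.
move=> [_ lamE _] n.
have cX : continuous (scaled_path B rho w) by exact: scaled_path_continuous.
have [u yu] := shootP (pi_gt0 R) (lam n) cX.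
apply: (dirichlet_eigenvalue_shooting cX _ yu).
have : range lam (lam n) by exists n.
rewrite lamE /=; apply: dirichlet_eigenvalue_eq => x.
rewrite in_itv/= => /andP[x0 xpi].
by rewrite /scaled_path clampE// !ltW.
Qed.

End assembly.

Unset Implicit Arguments.
Set Strict Implicit.

Theorem theorem3p3 (R : realType) (d : measure_display) (T : measurableType d)
    (P : probability T R) (B : R -> {RV P >-> R}) (rho : R)
    (lam : nat -> T -> R) :
  brownian_motion B ->
  rho != 0 ->
  (forall w : T,
     dirichlet_enumeration (fun x => rho * B x w) (fun n => lam n w)) ->
  exists Onr : set T,
    [/\ measurable Onr, P Onr = 1%E &
      forall w : T, Onr w ->
      forall c : {fsfun nat -> int with 0}, c != [fsfun] ->
        \sum_(n <- finsupp c) (c n)%:~R * lam n w != 0].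
Proof.
move=> BM rho0 lamE.
(* Integer lists form a countable type, and every finitely supported sequence is encoded by one of
   its initial segments. *)
have /choice[Z ZP] := fun c : seq int =>
  resonance_null BM rho0 (fun i : 'I_(size c) => (c`_i)%:~R : R).
have [mZ PZ] : measurable (\bigcup_c Z c) /\ P (\bigcup_c Z c) = 0%E.
  by apply: measure0_bigcup_countable => c; have [] := ZP c.
exists (~` \bigcup_c Z c); split.
- exact: measurableC.
- by rewrite probability_setC// PZ sube0.
move=> w wZ c c0; apply/eqP => res; apply: wZ.
(* One more than the largest index in the support, so that the segment of length [N] contains the
   whole support. *)
pose N := (\max_(n <- finsupp c) n).+1.
have cN n : n \in finsupp c -> (n < N)%N.
  by move=> nc; rewrite ltnS; apply: leq_bigmax_seq.
pose s := mkseq c N.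
have sE (i : 'I_(size s)) : s`_i = c i.
  by rewrite nth_mkseq// -(size_mkseq c N).
exists s => //; have [_ _ sZ] := ZP s.
have [lt_lam _ _] := lamE w.
apply: (sZ _ w (fun i => lam i w)).
- have [n nc] : exists n, n \in finsupp c.
    apply: contrapT => nosupp; move/eqP: c0; apply; apply/fsfunP => n.
    rewrite fsfun0E; apply/eqP; rewrite -memNfinsupp; apply/negP => nc.
    by apply: nosupp; exists n.
  have ns : (n < size s)%N by rewrite size_mkseq cN.
  exists (Ordinal ns); rewrite sE intr_eq0.
  by rewrite -mem_finsupp.
- move=> i j lij; apply/val_inj; have [ij|ji|//] := ltngtP i j.
  + by have := lt_lam _ _ ij; rewrite lij ltxx.
  + by have := lt_lam _ _ ji; rewrite lij ltxx.
- by move=> i; exact: (dirichlet_enumeration_shoot BM (lamE w)).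
- under eq_bigr do rewrite sE.
  rewrite -(sum_finsupp_ord (fun n => lam n w))//.
  by move=> n nc; rewrite size_mkseq cN.
Qed.
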